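(* Let $n,k\geq 2$ be integers. Let $P\in \mathbb{R}[X_1,\dots,X_n]$ be a polynomial of degree $k$ whose leading form (homogeneous part of degree $k$) is \[ P_k= Q_k+X_1Q_{k-1}+X_1^2Q_{k-2}+\cdots +X_1^kQ_0, \] where $Q_{k-i}\in \mathbb{R}[X_2,\dots,X_n]$ is a form of degree $k-i$ for all $0\leq i\leq k$. Suppose there are an integer $2\leq d\leq k$ and a proper (possibly empty) subset $\Sigma=\{X_{i_1},\dots,X_{i_m}\}\subsetneq \{X_2,\dots,X_n\}$ such that $Q_{k-i}\in \mathbb{R}[X_{i_1},\dots,X_{i_m}]$ for all $2\leq i \leq d-1$, and such that $Q_{k-1}$ contains (with nonzero coefficient) a monomial involving only variables of the complement $\{X_2,\dots,X_n\}\setminus \Sigma$. Define $s_d=\frac{d-1}{2d}$ and $s_\infty=\frac12$. Fix $s<s_\infty$ if $Q_{k-i}$ is identically zero for all $d\leq i\leq k$, and otherwise fix $s<s_d$. Then there exist a sequence of real numbers $R_j$ with $R_j\to\infty$ as $j\to\infty$ and a sequence of functions $f_j$ such that \[ \lim_{j\rightarrow \infty}\frac{\big\|\sup_{0<t<1} |T_t^Pf_j|\big\|_{L^1(B_n(0,1))}}{\|f_j\|_{H^s(\mathbb{R}^n)}} = \infty . \]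
   Context: A form of degree $e$ is a homogeneous polynomial of degree $e$; the zero polynomial is allowed. The Fourier transform is $\hat f(\xi)=\int_{\mathbb{R}^n} f(x)e^{-ix\cdot\xi}\,dx$. For a real polynomial $P$ in $n$ variables, define \[ T_t^{P}f(x) = \frac{1}{(2\pi)^n} \int_{\mathbb{R}^n} \hat{f}(\xi) e^{i(x\cdot \xi + P(\xi)t)}\,d\xi , \] initially for $f$ of Schwartz class on $\mathbb{R}^n$ (and extended to $H^s$ as the Fourier multiplier $e^{iP(\xi)t}$). The Sobolev space $H^s(\mathbb{R}^n)$ consists of all tempered distributions $f$ with finite norm given by $\|f\|_{H^s(\mathbb{R}^n)}^2=(2\pi)^{-n}\int_{\mathbb{R}^n}(1+|\xi|^2)^s|\hat f(\xi)|^2\,d\xi$. $B_n(0,1)$ is the unit ball in $\mathbb{R}^n$ centered at the origin. *)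

(* Defs.v *)
From HB Require Import structures.
From mathcomp Require Import all_boot all_order all_algebra.
(* The notations of mpoly clash with those of mathcomp-analysis. *)
From mathcomp.multinomials Require mpoly.
Import -(notations) mpoly.
From mathcomp Require Import all_classical all_reals all_analysis.
From mathcomp.real_closed Require Import complex.
Set Implicit Arguments.
Unset Strict Implicit.
Unset Printing Implicit Defensive.
Import Order.TTheory GRing.Theory Num.Theory.
Import numFieldNormedType.Exports.
Local Open Scope classical_set_scope.
Local Open Scope ring_scope.

Definition measure_rV_display (d : measure_display) : measure_display.
Proof. exact. Qed.

(* 'rV[R]_n carries the product sigma-algebra, i.e. the one generated by the
   coordinates. *)
Section measurable_rV.
Context {R : realType} (n : nat).

Let coors : 'I_n -> 'rV[R]_n -> R := fun i x => x ord0 i.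

Let rV_set0 : g_sigma_preimage coors set0.
Proof. exact: sigma_algebra0. Qed.

Let rV_setC A : g_sigma_preimage coors A -> g_sigma_preimage coors (~` A).
Proof. exact: sigma_algebraC. Qed.

Let rV_bigcup (F : (set 'rV[R]_n)^nat) :
  (forall i, g_sigma_preimage coors (F i)) ->
  g_sigma_preimage coors (\bigcup_i (F i)).
Proof. exact: sigma_algebra_bigcup. Qed.

HB.instance Definition _ :=
  @isMeasurable.Build (measure_rV_display default_measure_display) 'rV[R]_n
    (g_sigma_preimage coors) rV_set0 rV_setC rV_bigcup.

Lemma measurable_coord_rV (i : 'I_n) :
  measurable_fun [set: 'rV[R]_n] (fun x : 'rV[R]_n => x ord0 i).
Proof.
move=> _ Y mY; rewrite setTI; apply: sub_sigma_algebra => /=.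
rewrite -bigcup_seq/=; exists i => /=; first by rewrite mem_index_enum.
by exists Y => //; rewrite setTI.
Qed.

Lemma measurable_fun_rVP d (T : measurableType d) (f : T -> 'rV[R]_n) :
  measurable_fun [set: T] f <->
  forall i, measurable_fun [set: T] (fun t => f t ord0 i).
Proof.
split=> [mf i|mf].
  exact: (measurableT_comp (measurable_coord_rV i) mf).
have sub : g_sigma_preimage (fun i => coors i \o f) `<=` measurable.
  apply: smallest_sub; first exact: sigma_algebra_measurable.
  rewrite -bigcup_seq; apply: bigcup_sub => i _ A [B mB <-].
  exact: mf.
move=> _ A mA; apply: sub; rewrite g_sigma_preimage_comp.
by exists A => //; rewrite setTI.
Qed.

End measurable_rV.

Section lebesgue_rV.
Context {R : realType}.
Local Open Scope ereal_scope.

Definition consrV n (p : measurableTypeR R * 'rV[R]_n) : 'rV[R]_n.+1 :=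
  row_mx (p.1%:M : 'rV[R]_1) p.2.

Definition tailrV n (x : 'rV[R]_n.+1) : 'rV[R]_n :=
  \row_(j < n) x ord0 (lift ord0 j).

Lemma consrV0 n (p : measurableTypeR R * 'rV[R]_n) : consrV p ord0 ord0 = p.1.
Proof.
have := row_mxEl (p.1%:M : 'rV[R]_1) p.2 ord0 ord0.
rewrite [in RHS]mxE eqxx mulr1n => <-.
by congr (row_mx _ _ _ _); exact/val_inj.
Qed.

Lemma consrVS n (p : measurableTypeR R * 'rV[R]_n) (j : 'I_n) :
  consrV p ord0 (lift ord0 j) = p.2 ord0 j.
Proof.
have <- := row_mxEr (p.1%:M : 'rV[R]_1) p.2 ord0 j.
by congr (row_mx _ _ _ _); exact/val_inj.
Qed.

Lemma consrVK n (p : measurableTypeR R * 'rV[R]_n) : tailrV (consrV p) = p.2.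
Proof. by apply/rowP => j; rewrite mxE consrVS. Qed.

Lemma measurable_consrV n : measurable_fun [set: _] (@consrV n).
Proof.
apply/measurable_fun_rVP => i; case: (unliftP ord0 i) => [j|] ->; last first.
  under eq_fun do rewrite consrV0.
  exact: measurable_fst.
under eq_fun do rewrite consrVS.
exact: (measurableT_comp (measurable_coord_rV j) measurable_snd).
Qed.

Lemma measurable_tailrV n : measurable_fun [set: _] (@tailrV n).
Proof.
apply/measurable_fun_rVP => j.
under eq_fun do rewrite mxE.
exact: measurable_coord_rV.
Qed.

Section step.
Variables (n : nat) (mu : {sigma_finite_measure set 'rV[R]_n -> \bar R}).

Definition lebesgue_rV_step : set 'rV[R]_n.+1 -> \bar R :=
  pushforward (lebesgue_measure \x mu) (@consrV n).

Let step0 : lebesgue_rV_step set0 = 0.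
Proof. by rewrite /lebesgue_rV_step /pushforward preimage_set0 measure0. Qed.

Let step_ge0 A : 0 <= lebesgue_rV_step A.
Proof. exact: (measure_ge0 (lebesgue_measure \x mu)). Qed.

Let step_sigma_additive : semi_sigma_additive lebesgue_rV_step.
Proof.
move=> F mF tF mUF; rewrite /lebesgue_rV_step /pushforward preimage_bigcup.
apply: measure_semi_sigma_additive.
- by move=> k; rewrite -[X in measurable X]setTI; exact: measurable_consrV.
- apply/trivIsetP => /= i j _ _ ij; rewrite -preimage_setI.
  by move/trivIsetP : tF => /(_ _ _ _ _ ij) ->//; rewrite preimage_set0.
- rewrite -preimage_bigcup -[X in measurable X]setTI.
  exact: measurable_consrV.
Qed.

HB.instance Definition _ := isMeasure.Build _ _ _ lebesgue_rV_step
  step0 step_ge0 step_sigma_additive.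

Let step_sigma_finite : sigma_finite setT lebesgue_rV_step.
Proof.
have /sigma_finiteP[F [TF ndF Foo]] := sigma_finiteT (@lebesgue_measure R).
have /sigma_finiteP[G [TG ndG Goo]] := sigma_finiteT mu.
pose h (x : 'rV[R]_n.+1) := (x ord0 ord0 : measurableTypeR R, tailrV x).
have mh : measurable_fun setT h.
  apply/measurable_fun_pair; [exact: measurable_coord_rV|].
  exact: measurable_tailrV.
have hK p : h (consrV p) = p by case: p => a b; rewrite /h consrV0 consrVK.
exists (fun k => h @^-1` (F k `*` G k)).
  rewrite -preimage_bigcup (_ : \bigcup_k _ = setT) ?preimage_setT//.
  rewrite -subTset => -[x y] _.
  have [i _ Fix] : (\bigcup_i F i) x by rewrite -TF.
  have [j _ Gjy] : (\bigcup_i G i) y by rewrite -TG.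
  exists (maxn i j) => //; split.
    by move: x Fix; exact/subsetPset/ndF/leq_maxl.
  by move: y Gjy; exact/subsetPset/ndG/leq_maxr.
move=> k; have [mF Fkoo] := Foo k; have [mG Gkoo] := Goo k; split.
  by rewrite -[X in measurable X]setTI; apply: mh => //; exact: measurableX.
rewrite /lebesgue_rV_step /pushforward -comp_preimage.
rewrite (_ : h \o _ = id) ?preimage_id; last by apply/funext => p /=; rewrite hK.
by rewrite product_measure1E// lte_mul_pinfty// ge0_fin_numE.
Qed.

HB.instance Definition _ := Measure_isSigmaFinite.Build _ _ _ lebesgue_rV_step
  step_sigma_finite.

End step.

Fixpoint lebesgue_rV n : {sigma_finite_measure set 'rV[R]_n -> \bar R} :=
  match n with
  | 0 => \d_(0%R : 'rV[R]_0)
  | m.+1 => lebesgue_rV_step (lebesgue_rV m)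
  end.

End lebesgue_rV.

Section polynomials.
Context {R : realType} {n : nat}.

Definition monomial_in (S : {set 'I_n}) (m : multinom n) : Prop :=
  forall i, i \notin S -> m i = 0%N.

Definition mpoly_in (S : {set 'I_n}) (p : mpoly n R) : Prop :=
  forall m, m \in msupp p -> monomial_in S m.

End polynomials.

Section fourier_analysis.
Context {R : realType} {n : nat}.
Local Open Scope complex_scope.
Implicit Types (f : 'rV[R]_n -> R[i]) (g : 'rV[R]_n -> R) (x xi : 'rV[R]_n).

Definition dotrV (x y : 'rV[R]_n) : R := \sum_(i < n) x ord0 i * y ord0 i.

(* The library norm `|x| on 'rV[R]_n is the sup norm. *)
Definition enorm x : R := Num.sqrt (dotrV x x).

Definition expi (theta : R) : R[i] := cos theta +i* sin theta.

Definition Cintegral f : R[i] :=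
  (\int[lebesgue_rV n]_x complex.Re (f x)) +i*
  (\int[lebesgue_rV n]_x complex.Im (f x)).

Definition fourier f xi : R[i] :=
  Cintegral (fun x => f x * expi (- dotrV x xi)).

(* A multi-index is encoded as the list of the variables to differentiate in,
   with repetitions. *)
Definition iter_partial (l : seq 'I_n) g : 'rV[R]_n -> R :=
  foldr (fun i h x => 'D_(delta_mx ord0 i) h x) g l.

Definition schwartz_real g : Prop :=
  forall l : seq 'I_n,
    (forall x, differentiable (iter_partial l g) x) /\
    (forall N : nat, exists C : R, forall x,
      (1 + enorm x) ^+ N * `|iter_partial l g x| <= C).

Definition schwartz f : Prop :=
  schwartz_real (fun x => complex.Re (f x)) /\
  schwartz_real (fun x => complex.Im (f x)).

(* The integrals converge absolutely for Schwartz f, which is the only case in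
   which this is meant to be used. *)
Definition propagator (P : mpoly n R) (t : R) f x : R[i] :=
  ((2 * pi) ^- n)%:C *
  Cintegral (fun xi =>
    fourier f xi * expi (dotrV x xi + meval (fun i => xi ord0 i) P * t)).

Definition maximal_function (P : mpoly n R) f x : \bar R :=
  ereal_sup [set (Normc.normc (propagator P t f x))%:E | t in `]0, 1[%classic].

Definition L1_unit_ball (F : 'rV[R]_n -> \bar R) : \bar R :=
  (\int[lebesgue_rV n]_(x in [set x | (enorm x < 1)%R]) `|F x|)%E.

Definition sobolev_norm (s : R) f : \bar R :=
  (((2 * pi) ^- n)%:E * \int[lebesgue_rV n]_xi
     ((1 + enorm xi ^+ 2) `^ s * Normc.normc (fourier f xi) ^+ 2)%:E)%E `^ 2^-1.

End fourier_analysis.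

(* Main.v *)
Require Import Defs.
From mathcomp Require Import all_boot all_order all_algebra.
From mathcomp.multinomials Require mpoly.
Import -(notations) mpoly.
From mathcomp Require Import all_classical all_reals all_analysis.
From mathcomp Require Import measurable_realfun lebesgue_integral_under.
From mathcomp Require Import normal_distribution.
From mathcomp.real_closed Require Import complex.
From mathcomp Require Import ring lra.
Import Order.TTheory GRing.Theory Num.Theory.
Import numFieldNormedType.Exports.
Local Open Scope classical_set_scope.
Local Open Scope ring_scope.
Set Implicit Arguments.
Unset Strict Implicit.
Unset Printing Implicit Defensive.

(* Fix a frequency vector w with w_1 = 0, with w_i = 0 for the variables in
   Sigma, and with q = Q_{k-1}(w) <> 0.  Put (a, b) = (1, 1) if the Q_{k-i} with
   i >= d vanish and (a, b) = (d, d - 1) otherwise.  For N = 1, 2, ... take f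
   with Gaussian Fourier transform centered at N^a w, of width N^b in the first
   variable and of width 1 in the others.  Put t = - x_1 / (q N^(a (k - 1))) and
   xi = N^a w + (N^b v_1, v_2, ..., v_n).  In x . xi + t P(xi) the term
   t N^b v_1 Q_{k-1}(N^a w) cancels x_1 N^b v_1, and for x in a small fixed box
   everything else differs from a constant by a small multiple of a polynomial
   in v: b <= a handles the lower order terms, the monomials of Q_k and of
   X_1 Q_{k-1}, and those X_1^i Q_{k-i} which only involve Sigma; the choice of
   (a, b) handles the others.  So there is no cancellation in the integral and
   sup_t |T_t f| is of size N^b on the box, whereas the H^s norm of f is
   O(N^(a max(s, 0) + b / 2)).  The quotient is at least of size
   N^(b / 2 - a max(s, 0)), and b / (2 a) is the threshold on s. *)

(** * Gaussians on the line *)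

(** The exponents come from counting powers of N. Since t has size N^(- a (k - 1)), a term of P may
    contribute O(N^(a (k - 1))) to the phase polynomial. At frequencies of size N^b in X_1 and at
    most N^a elsewhere, X_1^i Q_{k-i} is O(N^(b i + a (k - i))), which is allowed once b i <= a (i -
    1). For i >= d the worst case is i = d, whence b / a = (d - 1) / d. For 2 <= i < d this count
    fails at that ratio, and this is why w vanishes on Sigma: Q_{k-i} then stays bounded, the term
    is O(N^(b i)), and i <= k - 1. A monomial of Q_{k-1} off Sigma is what allows Q_{k-1}(w) <> 0
    for such a w.

    No stationary phase is involved. The phase error is at most delta times a power of a weight in
    v; against the Gaussian, that power is absorbed by a Gaussian sqrt 2 times as wide, with a
    constant independent of N. One small delta therefore works for every N. Replacing s by max(s, 0)
    only enlarges the Sobolev norm, because its weight is a power of a quantity that is at least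
    1. *)

Section one_dimensional.
Context {R : realType}.
Notation mu := (@lebesgue_measure R).
Implicit Types m s t x y z : R.

Lemma exp_dominates_power (K : nat) (e : R) : 0 < e ->
  exists2 C : R, 0 < C & forall y : R, (1 + `|y|) ^+ K <= C * expR (e * y ^+ 2).
Proof.
(* The case of exponent 1 with constant c, raised to the power K, gives the claim because K c <= e;
   [K.+1] keeps the quotient meaningful for K = 0. *)
move=> e0; pose c := e / K.+1%:R.
have c0 : 0 < c by rewrite divr_gt0.
exists (2 ^+ K * (1 + c^-1) ^+ K); first by rewrite mulr_gt0 ?exprn_gt0//
  addr_gt0 ?invr_gt0.
move=> y; rewrite -exprMn.
have H0 : 1 + `|y| <= 2 * (1 + c^-1) * expR (c * y ^+ 2).
  have := expR_ge1Dx (c * y ^+ 2) => H1.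
  have H2 : 0 < c^-1 by rewrite invr_gt0.
  have H4 : 1 + y ^+ 2 <= (1 + c^-1) * (1 + c * y ^+ 2).
    have -> : (1 + c^-1) * (1 + c * y ^+ 2) = 1 + y ^+ 2 + (c^-1 + c * y ^+ 2).
      by rewrite mulrDl mul1r mulrDr mulr1 mulKf ?gt_eqF//; ring.
    by rewrite lerDl; apply: addr_ge0; [exact: ltW|apply: mulr_ge0;
      [exact: ltW|exact: sqr_ge0]].
  have H5 : 1 + `|y| <= 2 * (1 + y ^+ 2).
    rewrite -(real_normK (num_real y)); have := sqr_ge0 (`|y| - 1); nra.
  apply: (le_trans H5); rewrite -mulrA ler_pM2l//; apply: (le_trans H4).
  by rewrite ler_pM2l// addr_gt0.
apply: (@le_trans _ _ ((2 * (1 + c^-1) * expR (c * y ^+ 2)) ^+ K)).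
  by rewrite lerXn2r// nnegrE ?addr_ge0// !mulr_ge0 ?addr_ge0 ?invr_ge0//
    ?expR_ge0// ltW.
rewrite [leLHS]exprMn ler_pM2l ?exprn_gt0 ?mulr_gt0 ?addr_gt0 ?invr_gt0//.
rewrite -expRM_natl ler_expR mulrA ler_wpM2r ?sqr_ge0//.
by rewrite /c mulrCA ger_pMr// ler_pdivrMr// mul1r ler_nat.
Qed.

Lemma normal_fun_pdf m s : s != 0 ->
  normal_fun m s = fun x => (normal_peak s)^-1 * normal_pdf m s x.
Proof.
move=> s0; apply/funext => x; rewrite normal_pdfE// mulKf//.
by rewrite gt_eqF// normal_peak_gt0.
Qed.

Lemma integrable_normal_fun m s : s != 0 ->
  mu.-integrable [set: R] (EFin \o normal_fun m s).
Proof.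
move=> s0; rewrite normal_fun_pdf//.
have := integrableZl measurableT ((normal_peak s)^-1) (integrable_normal_pdf m s).
by apply: eq_integrable => //.
Qed.

Lemma integral_normal_fun m s : s != 0 ->
  (\int[mu]_x (normal_fun m s x)%:E)%E = ((normal_peak s)^-1)%:E.
Proof.
move=> s0; rewrite normal_fun_pdf//.
under eq_integral do rewrite EFinM.
rewrite integralZl//; last exact: integrable_normal_pdf.
by rewrite integral_normal_pdf mule1.
Qed.

Lemma is_derive_normal_fun0 s (x : R) : s != 0 ->
  is_derive x 1 (normal_fun 0 s) (- (x / s ^+ 2) * normal_fun 0 s x).
Proof.
move=> s0; rewrite /normal_fun.
under eq_fun do rewrite subr0.
apply: is_derive_eq.
rewrite /= /GRing.scale/= subr0 mulrC; congr (_ * _).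
by rewrite -mulr_natr; field; rewrite s0.
Qed.

(** Serves as integration by parts on the whole line without boundary terms. The fundamental theorem
    is applied on growing intervals, and dominated convergence passes to the limit. *)
Lemma integral_derivative_eq0 (F f : R -> R) :
  (forall x, is_derive x 1 F (f x)) -> continuous f ->
  mu.-integrable [set: R] (EFin \o f) ->
  F x @[x --> +oo] --> (0 : R) -> F x @[x --> -oo] --> (0 : R) ->
  \int[mu]_x f x = 0.
Proof.
move=> dF cf intf Fy FNy.
(* Truncation at [k.+1] rather than [k] keeps every interval nondegenerate, as the fundamental
   theorem requires. *)
pose f_ (k : nat) (x : R) : \bar R := (f x * \1_(`[- k.+1%:R, k.+1%:R]%classic :
  set R) x)%:E.
have mf : measurable_fun [set: R] (fun x : R => (f x)%:E) by exact:
  measurable_int intf.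
have mf_ k : measurable_fun [set: R] (f_ k).
  apply/measurable_EFinP; apply: measurable_funM; first exact/measurable_EFinP.
  exact: measurable_indic.
have fk k : (\int[mu]_x f_ k x = (F k.+1%:R - F (- k.+1%:R))%:E)%E.
  transitivity (\int[mu]_(x in `[(- k.+1%:R)%R, (k.+1%:R)%R]) (f x)%:E)%E.
    rewrite [RHS]integral_mkcond; apply: eq_integral => x _.
    rewrite /f_ patchE indicE; case: ifPn => // _; first by rewrite mulr1.
    by rewrite mulr0.
  have k0 : - (k.+1%:R : R) < k.+1%:R by rewrite gtrN.
  rewrite (@continuous_FTC2 _ f F)//.
  - exact: continuous_subspaceT.
  - have cF x : F @ x --> F x.
      by apply: differentiable_continuous; apply/derivable1_diffP.
    split.
    + by move=> x _; apply: ex_derive.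
    + exact/cvg_at_right_filter/cF.
    + exact/cvg_at_left_filter/cF.
  - by move=> x _; rewrite derive1E derive_val.
have H1 : {ae mu, forall x, [set: R] x -> f_ ^~ x @ \oo --> (EFin \o f) x}.
  apply/aeW => x _; apply: cvg_near_cst; near=> k.
  rewrite /f_ indicE mem_set ?mulr1//= in_itv/= -ler_norml.
  apply: (@le_trans _ _ k%:R); last by rewrite ler_nat.
  by near: k; exact: nbhs_infty_ger.
have H2 : {ae mu, forall x n, [set: R] x -> (`|f_ n x| <= `|(EFin \o f) x|)%E}.
  apply/aeW => x k _; rewrite /f_ /= lee_fin normrM ler_piMr//.
  by rewrite indicE; case: (_ \in _); rewrite ?normr1 ?normr0.
have [_ _ H] := @dominated_convergence _ _ _ mu _ measurableT f_ (EFin \o f)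
  (fun x => `|(EFin \o f) x|)%E mf_ mf H1 (integrable_abse intf) H2.
have H3 : ((F k.+1%:R - F (- k.+1%:R))%:E @[k --> \oo] --> (0 - 0 : R)%:E)%E.
  apply: cvg_EFin; first exact: nearW.
  apply: cvgB.
    by apply: (cvg_comp _ _ _ Fy); apply/cvgryPge => A; near=> k;
      rewrite (@le_trans _ _ k%:R) ?ler_nat//; near: k; exact: nbhs_infty_ger.
  apply: (cvg_comp _ _ _ FNy); apply/cvgrNyPle => A; near=> k.
  rewrite lerNl (@le_trans _ _ k%:R) ?ler_nat//; near: k; exact: nbhs_infty_ger.
rewrite subrr in H3.
rewrite /Rintegral; have -> : (\int[mu]_x (f x)%:E = 0)%E; last by [].
have : (fun n => \int[mu]_x f_ n x)%E @ \oo --> (\int[mu]_x (f x)%:E)%E by exact: H.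
under eq_fun do rewrite fk.
by move=> H4; apply: (cvg_unique _ H4 H3).
Unshelve. all: by end_near. Qed.

End one_dimensional.

Section gaussian_fourier.
Context {R : realType}.
Notation mu := (@lebesgue_measure R).
Implicit Types m s t x y z : R.

(** With z = (x - m) / s, split exp(- z^2 / 2) as exp(- z^2 / 4) times itself: one factor absorbs
    the polynomial, the other is the Gaussian of width sqrt 2 s. It matters that C is uniform in m
    and s, since the packets move and widen with N. *)
Lemma normal_fun_power (K : nat) : exists2 C : R, 0 < C &
  forall m s x, s != 0 -> (1 + `|(x - m) / s|) ^+ K * normal_fun m s x
    <= C * normal_fun m (Num.sqrt 2 * s) x.
Proof.
have [|C C0 HC] := @exp_dominates_power R K 4^-1; first by rewrite invr_gt0.
exists C => // m s x s0.
have -> : normal_fun m (Num.sqrt 2 * s) x = expR (4^-1 * ((x - m) / s) ^+ 2) *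
  normal_fun m s x.
  rewrite -expRD; congr expR; rewrite exprMn sqr_sqrtr// -[s ^+ 2 *+ 2]mulr_natr
    -[_ *+ 2]mulr_natr.
  by field.
by rewrite mulrA ler_pM2r ?expR_gt0.
Qed.

Lemma integrable_le_normal_fun (h : R -> R) (C m s : R) :
  s != 0 -> measurable_fun [set: R] h ->
  (forall x, `|h x| <= C * normal_fun m s x) ->
  mu.-integrable [set: R] (EFin \o h).
Proof.
move=> s0 mh hC.
have := (integrableZl measurableT C (integrable_normal_fun m s0)).
apply: le_integrable => // [|x _].
  exact/measurable_EFinP.
by rewrite /= lee_fin; exact: le_trans (hC x) (ler_norm _).
Qed.

Lemma measurable_cosD (y t : R) : measurable_fun [set: R] (fun x => cos (y * x +
  t)).
Proof.
apply: continuous_measurable_fun => x.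
apply: continuous_comp; last exact: continuous_cos.
by apply: cvgD; [apply: cvgM; [exact: cvg_cst|exact: cvg_id]|exact: cvg_cst].
Qed.

Lemma cvg_normal_fun0 s : 0 < s -> normal_fun 0 s x @[x --> +oo] --> (0 : R).
Proof.
move=> s0.
have -> : normal_fun 0 s = (fun x => gauss_fun (x * (Num.sqrt 2 * s)^-1)).
  apply/funext => x; rewrite /normal_fun /gauss_fun; congr expR.
  rewrite subr0 !exprMn exprVn exprMn sqr_sqrtr// -[s ^+ 2 *+ 2]mulr_natr.
  by field; rewrite gt_eqF.
apply: (cvg_comp (fun x => x * (Num.sqrt 2 * s)^-1) _ _ cvg_gauss_fun).
apply: gt0_cvgMly; last exact: cvg_id.
by rewrite invr_gt0 mulr_gt0// sqrtr_gt0.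
Qed.

Lemma cvg_normal_fun_sin s (y t : R) : 0 < s ->
  normal_fun 0 s x * sin (y * x + t) @[x --> +oo] --> (0 : R).
Proof.
move=> s0; apply: norm_cvg0.
apply: (@squeeze_cvgr _ _ _ _ (cst 0) (normal_fun 0 s)).
- apply: nearW => x; rewrite normr_ge0/= normrM ger0_norm ?normal_fun_ge0//.
  by rewrite ler_piMr ?normal_fun_ge0// sin_max.
- exact: cvg_cst.
- exact: cvg_normal_fun0.
Qed.

Lemma continuous_normal_fun m s : s != 0 -> continuous (@normal_fun R m s).
Proof.
move=> s0; rewrite normal_fun_pdf// => x.
by apply: cvgM; [exact: cvg_cst|exact: continuous_normal_pdf].
Qed.

Lemma is_derive_cosD (y t x : R) :
  is_derive x 1 (fun x => cos (y * x + t)) (- (y * sin (y * x + t))).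
Proof.
apply: is_derive_eq; rewrite /GRing.scale/=.
by ring.
Qed.

Lemma is_derive_sinD (y t x : R) :
  is_derive x 1 (fun x => sin (y * x + t)) (y * cos (y * x + t)).
Proof.
apply: is_derive_eq; rewrite /GRing.scale/=.
by ring.
Qed.

Lemma integrable_normal_fun_cos s (y t : R) : s != 0 ->
  mu.-integrable [set: R] (EFin \o (fun x => normal_fun 0 s x * cos (y * x + t))).
Proof.
move=> s0; apply: (@integrable_le_normal_fun _ 1 0 s) => //.
  apply: measurable_funM; first exact: measurable_normal_fun.
  exact: measurable_cosD.
move=> x; rewrite mul1r normrM ger0_norm ?normal_fun_ge0//.
by rewrite ler_piMr ?normal_fun_ge0// cos_max.
Qed.

Let measurable_sinD (y t : R) : measurable_fun [set: R] (fun x => sin (y * x + t)).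
Proof.
apply: continuous_measurable_fun => x.
apply: continuous_comp; last exact: continuous_sin.
by apply: cvgD; [apply: cvgM; [exact: cvg_cst|exact: cvg_id]|exact: cvg_cst].
Qed.

Let integrable_xnormal_fun_sin s (y t : R) : s != 0 ->
  mu.-integrable [set: R] (EFin \o (fun x => x * normal_fun 0 s x * sin (y * x +
    t))).
Proof.
move=> s0; have [C C0 HC] := normal_fun_power 1.
apply: (@integrable_le_normal_fun _ (`|s| * C) 0 (Num.sqrt 2 * s)) => //.
- by rewrite mulf_neq0// gt_eqF// sqrtr_gt0.
- apply: measurable_funM; last exact: measurable_sinD.
  by apply: measurable_funM => //; exact: measurable_normal_fun.
- move=> x; rewrite -mulrA; apply: (@le_trans _ _ (`|s| * ((1 + `|(x - 0) / s|)
    ^+ 1 * normal_fun 0 s x))).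
    have -> : x * (normal_fun 0 s x * sin (y * x + t)) = x * sin (y * x + t) *
      normal_fun 0 s x by ring.
    rewrite expr1 subr0 normrM (ger0_norm (normal_fun_ge0 _ _ _)) mulrA.
    rewrite ler_wpM2r ?normal_fun_ge0// mulrDr mulr1 -normrM.
    rewrite [s * _]mulrCA divff// mulr1 normrM.
    by rewrite (@le_trans _ _ `|x|)// ?ler_piMr ?sin_max// lerDr.
  by rewrite -mulrA ler_wpM2l// HC.
Qed.

(** The function - s^2 G(x) sin(y x + t), where G is [normal_fun 0 s], vanishes at both infinities
    and its derivative is the difference of the two integrands. *)
Let gaussian_ibp s (y t : R) : 0 < s ->
  \int[mu]_x (x * normal_fun 0 s x * sin (y * x + t)) =
  s ^+ 2 * y * \int[mu]_x (normal_fun 0 s x * cos (y * x + t)).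
Proof.
move=> s0; have sn0 : s != 0 by rewrite gt_eqF.
have iS := integrable_xnormal_fun_sin y t sn0.
have iC := integrable_normal_fun_cos y t sn0.
have iC' : mu.-integrable [set: R] (EFin \o (fun x => s ^+ 2 * y * (normal_fun 0
  s x * cos (y * x + t)))).
  by have := integrableZl measurableT (s ^+ 2 * y) iC; apply: eq_integrable.
apply/eqP; rewrite -subr_eq0 -RintegralZl// -RintegralB//; apply/eqP.
apply: (@integral_derivative_eq0 _ (fun x => - (s ^+ 2) * (normal_fun 0 s x * sin
  (y * x + t)))).
- move=> x.
  have d := is_deriveZ (- s ^+ 2) (is_deriveM (is_derive_normal_fun0 x sn0)
    (is_derive_sinD y t x)).
  by apply: (is_derive_eq d); rewrite /GRing.scale/=; field.
- move=> x; apply: cvgB; apply: cvgM.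
  + by apply: cvgM; [exact: cvg_id|exact: continuous_normal_fun].
  + by apply: differentiable_continuous; apply/derivable1_diffP;
      apply: ex_derive; exact: is_derive_sinD.
  + exact: cvg_cst.
  + apply: cvgM; first exact: continuous_normal_fun.
    by apply: differentiable_continuous; apply/derivable1_diffP;
      apply: ex_derive; exact: is_derive_cosD.
- have := integrableB measurableT iS iC'; apply: eq_integrable => //.
- have := cvgM (cvg_cst (- s ^+ 2)) (cvg_normal_fun_sin y t s0).
  by rewrite mulr0; apply.
(* The limit at -oo follows from the one at +oo: the Gaussian is even, and x -> - x replaces y by -
   y. *)
- have H := cvg_normal_fun_sin (- y) t s0.
  have E : (fun x => normal_fun 0 s x * sin (- y * x + t)) =
      (fun x => normal_fun 0 s (- x) * sin (y * - x + t)).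
    by apply/funext => x; rewrite mulrN mulNr /normal_fun !subr0 sqrrN.
  rewrite E in H.
  have H1 : normal_fun 0 s x * sin (y * x + t) @[x --> -oo] --> (0 : R).
    by apply/cvgNy_compNP; exact: H.
  by have := cvgM (cvg_cst (- s ^+ 2)) H1; rewrite mulr0; apply.
Qed.

Let is_derive_gaussian_cos s (y t : R) : 0 < s ->
  is_derive y 1 (fun y => \int[mu]_x (normal_fun 0 s x * cos (y * x + t)))
    (- (s ^+ 2 * y * \int[mu]_x (normal_fun 0 s x * cos (y * x + t)))).
Proof.
move=> s0; have sn0 : s != 0 by rewrite gt_eqF.
pose f (y x : R) := normal_fun 0 s x * cos (y * x + t).
have dfx x z : is_derive z 1 (f ^~ x) (- (x * normal_fun 0 s x * sin (z * x + t))).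
  rewrite /f; under eq_fun do rewrite [_ * x]mulrC.
  have := is_derive_cosD x t z => d1.
  apply: is_derive_eq; rewrite /GRing.scale/= [z * x]mulrC; ring.
have ID : (y : R) \in `](y - 1), (y + 1)[ by rewrite in_itv/=; apply/andP; split;
  lra.
(* As sin(pi / 2) = 1, this is the dominating function |x| times the Gaussian, written so that its
   integrability is an instance of the previous lemma. *)
pose G (x : R) := `|x * normal_fun 0 s x * sin (0 * x + pi / 2)|.
have iG : mu.-integrable [set: R] (EFin \o G).
  have := integrable_abse (integrable_xnormal_fun_sin 0 (pi / 2) sn0).
  exact: eq_integrable.
have intf z : (`]y - 1, y + 1[%classic : set R) z -> mu.-integrable [set: R]
  (EFin \o f z).
  by move=> _; exact: integrable_normal_fun_cos.
have derf z x : (`]y - 1, y + 1[%classic : set R) z -> [set: R] x -> derivable (f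
  ^~ x) z 1.
  by move=> _ _; apply: ex_derive.
have Gub z x : (`]y - 1, y + 1[%classic : set R) z -> [set: R] x -> `|partial1of2
  f z x| <= G x.
  move=> _ _; rewrite partial1of2E derive_val /G normrN normrM.
  by rewrite mul0r add0r sin_pihalf mulr1 ler_piMr// sin_max.
have G0 x : 0 <= G x by exact: normr_ge0.
apply: DeriveDef.
  exact: (@derivable_under_integral _ _ _ mu f _ measurableT _ _ _ ID intf derf G
    G0 iG Gub).
rewrite -derive1E (@differentiation_under_integral _ _ _ mu f _ measurableT _ _ _
  ID intf derf G G0 iG Gub).
rewrite -gaussian_ibp// -mulN1r -RintegralZl//;
  last exact: integrable_xnormal_fun_sin.
by apply: eq_Rintegral => x _; rewrite partial1of2E derive_val mulN1r.
Qed.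

(* As functions of [y], both sides solve the equation [F' = - s ^+ 2 * y * F]. *)
Lemma gaussian_cos s (y t : R) : 0 < s ->
  \int[mu]_x (normal_fun 0 s x * cos (y * x + t)) =
  (normal_peak s)^-1 * (cos t * expR (- (s ^+ 2 * y ^+ 2) / 2)).
Proof.
move=> s0; have sn0 : s != 0 by rewrite gt_eqF.
(* Multiplying by the integrating factor exp(s^2 y^2 / 2) makes the function constant in y, so its
   value at 0 determines it. *)
pose H y := \int[mu]_x (normal_fun 0 s x * cos (y * x + t)) * expR (s ^+ 2 * y ^+
  2 / 2).
have dH (z : R) : is_derive z 1 H 0.
  have := is_derive_gaussian_cos z t s0 => d1.
  apply: is_derive_eq; rewrite /GRing.scale/=.
  by field.
have H0 : H 0 = (normal_peak s)^-1 * cos t.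
  rewrite /H expr0n/= mulr0 mul0r expR0 mulr1.
  under eq_Rintegral do rewrite mul0r add0r.
  rewrite RintegralZr//; last exact: integrable_normal_fun.
  by rewrite /Rintegral integral_normal_fun.
have := is_derive_0_is_cst y 0 dH; rewrite H0 => E.
by rewrite mulrA -E /H -[RHS]mulrA -expRD mulNr addrN expR0 mulr1.
Qed.

End gaussian_fourier.

(** * Integration over [lebesgue_rV] *)

Section lebesgue_rV_fubini.
Context {R : realType}.
Notation mu := (@lebesgue_measure R).
Notation leb := (@lebesgue_rV R).

Lemma ge0_integral_rVS n (f : 'rV[R]_n.+1 -> \bar R) :
  measurable_fun [set: 'rV[R]_n.+1] f -> (forall x, 0 <= f x)%E ->
  (\int[leb n.+1]_x f x = \int[mu]_x \int[leb n]_y f (consrV (x, y)))%E.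
Proof.
move=> mf f0.
transitivity (\int[mu \x leb n]_z (f \o @consrV R n) z)%E.
  exact: (@ge0_integral_pushforward _ _ _ _ _ _ (@measurable_consrV R n) (mu \x
    leb n)%E setT).
rewrite fubini_tonelli1//; last by move=> x; exact: f0.
by apply: measurableT_comp => //; exact: measurable_consrV.
Qed.

Lemma integral_rVS n (f : 'rV[R]_n.+1 -> \bar R) :
  (leb n.+1).-integrable [set: 'rV[R]_n.+1] f ->
  (\int[leb n.+1]_x f x = \int[mu]_x \int[leb n]_y f (consrV (x, y)))%E.
Proof.
move=> intf; have mf := measurable_int _ intf.
have mfc : measurable_fun [set: measurableTypeR R * 'rV[R]_n] (f \o @consrV R n).
  by apply: measurableT_comp => //; exact: measurable_consrV.
have intfc : (mu \x leb n)%E.-integrable setT (f \o @consrV R n).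
  apply/integrableP; split => //.
  case/integrableP: intf => _; congr (_ < _)%E.
  apply: (@ge0_integral_pushforward _ _ _ _ _ _ (@measurable_consrV R n) (mu \x
    leb n)%E setT) => //.
  exact: measurableT_comp.
transitivity (\int[mu \x leb n]_z (f \o @consrV R n) z)%E.
  exact: (@integral_pushforward _ _ _ _ _ _ (@measurable_consrV R n) (mu \x leb
    n)%E setT).
by rewrite -integral12_prod_meas1.
Qed.

Lemma measurable_prod_rV n (g : 'I_n -> R -> R) :
  (forall i, measurable_fun [set: R] (g i)) ->
  measurable_fun [set: 'rV[R]_n] (fun x : 'rV[R]_n => \prod_(i < n) g i (x ord0 i)).
Proof.
move=> mg; apply: measurable_prod => i _.
by apply: (measurableT_comp (mg i)); exact: measurable_coord_rV.
Qed.

Lemma prod_consrV n (g : 'I_n.+1 -> R -> R) (x : R) (y : 'rV[R]_n) :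
  \prod_(i < n.+1) g i (consrV (x, y) ord0 i) =
  g ord0 x * \prod_(i < n) g (lift ord0 i) (y ord0 i).
Proof.
rewrite big_ord_recl consrV0; congr (_ * _).
by apply: eq_bigr => i _; rewrite consrVS.
Qed.

Lemma integral_prod_rV n (g : 'I_n -> R -> R) (c : 'I_n -> R) :
  (forall i, measurable_fun [set: R] (g i)) ->
  (forall i x, 0 <= g i x) ->
  (forall i, \int[mu]_x (g i x)%:E = (c i)%:E)%E ->
  (\int[leb n]_x (\prod_(i < n) g i (x ord0 i))%:E = (\prod_(i < n) c i)%:E)%E.
Proof.
elim: n g c => [|n IH] g c mg g0 gc.
  rewrite big_ord0; under eq_integral do rewrite big_ord0.
  by rewrite integral_cst//= diracT mule1.
rewrite ge0_integral_rVS; last 2 first.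
- by apply/measurable_EFinP; exact: measurable_prod_rV.
- by move=> x; rewrite lee_fin; apply: prodr_ge0.
under eq_integral => x _.
  under eq_integral do rewrite prod_consrV EFinM.
  rewrite ge0_integralZl//; last 3 first.
  - by apply/measurable_EFinP; exact: (measurable_prod_rV (g := fun i => g (lift
      ord0 i))).
  - by move=> y _; rewrite lee_fin; apply: prodr_ge0.
  - by rewrite lee_fin.
  rewrite (IH (fun i => g (lift ord0 i)) (fun i => c (lift ord0 i)))//.
  over.
rewrite /= ge0_integralZr//.
- by rewrite gc big_ord_recl EFinM.
- by apply/measurable_EFinP; exact: mg.
- by move=> x _; rewrite lee_fin.
- rewrite lee_fin; apply: prodr_ge0 => i _.
  by rewrite -lee_fin -gc integral_ge0// => x _; rewrite lee_fin.
Qed.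

(** Not normalized to mass one: its values stay in (0, 1], so that its square is bounded by itself
    in the Sobolev estimate. *)
Definition gaussian_rV n (m s : 'I_n -> R) (x : 'rV[R]_n) : R :=
  \prod_(i < n) normal_fun (m i) (s i) (x ord0 i).

Lemma measurable_gaussian_rV n (m s : 'I_n -> R) :
  measurable_fun [set: 'rV[R]_n] (gaussian_rV m s).
Proof.
apply: (measurable_prod_rV (g := fun i => normal_fun (m i) (s i))) => i.
exact: measurable_normal_fun.
Qed.

Lemma gaussian_rV_gt0 n (m s : 'I_n -> R) x : 0 < gaussian_rV m s x.
Proof. by apply: prodr_gt0 => i _; exact: expR_gt0. Qed.

Lemma integral_gaussian_rV n (m s : 'I_n -> R) : (forall i, s i != 0) ->
  (\int[leb n]_x (gaussian_rV m s x)%:E =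
   (\prod_(i < n) (normal_peak (s i))^-1)%:E)%E.
Proof.
move=> s0.
apply: (integral_prod_rV (g := fun i => normal_fun (m i) (s i))) => i.
- exact: measurable_normal_fun.
- exact: normal_fun_ge0.
- exact: integral_normal_fun.
Qed.

Lemma integrable_gaussian_rV n (m s : 'I_n -> R) : (forall i, s i != 0) ->
  (leb n).-integrable [set: 'rV[R]_n] (EFin \o gaussian_rV m s).
Proof.
move=> s0; apply/integrableP; split.
  by apply/measurable_EFinP; exact: measurable_gaussian_rV.
under eq_integral do rewrite /= ger0_norm ?(ltW (gaussian_rV_gt0 _ _ _))//.
by rewrite integral_gaussian_rV// ltry.
Qed.

Lemma integrable_le_gaussian_rV n (h : 'rV[R]_n -> R) (C : R) (m s : 'I_n -> R) :
  (forall i, s i != 0) -> measurable_fun [set: 'rV[R]_n] h ->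
  (forall x, `|h x| <= C * gaussian_rV m s x) ->
  (leb n).-integrable [set: 'rV[R]_n] (EFin \o h).
Proof.
move=> s0 mh hC.
have := integrableZl measurableT C (integrable_gaussian_rV m s0).
apply: le_integrable => // [|x _].
  exact/measurable_EFinP.
by rewrite /= lee_fin; exact: le_trans (hC x) (ler_norm _).
Qed.

Lemma measurable_linear_rV n (y : 'I_n -> R) (t : R) :
  measurable_fun [set: 'rV[R]_n] (fun x : 'rV[R]_n => \sum_(i < n) y i * x ord0 i
    + t).
Proof.
apply: measurable_funD => //; apply: measurable_sum => i.
by apply: measurable_funM => //; exact: measurable_coord_rV.
Qed.

Lemma measurable_cos_comp d (T : measurableType d) (f : T -> R) :
  measurable_fun [set: T] f -> measurable_fun [set: T] (fun x => cos (f x)).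
Proof.
move=> mf; apply: (measurableT_comp (f := @cos R)) => //.
by apply: continuous_measurable_fun; exact: continuous_cos.
Qed.

Lemma integrable_gaussian_rV_cos n (m s : 'I_n -> R) (h : 'rV[R]_n -> R) :
  (forall i, s i != 0) -> measurable_fun [set: 'rV[R]_n] h ->
  (leb n).-integrable [set: 'rV[R]_n]
    (EFin \o (fun x => gaussian_rV m s x * cos (h x))).
Proof.
move=> s0 mh; apply: (@integrable_le_gaussian_rV _ _ 1 m s) => //.
  by apply: measurable_funM; [exact: measurable_gaussian_rV|exact:
    measurable_cos_comp].
move=> x; have g0 := ltW (gaussian_rV_gt0 m s x).
by rewrite mul1r normrM ger0_norm// ler_piMr// cos_max.
Qed.

(** The free phase t is what makes the induction on n go through: for a fixed first coordinate x,
    the term y_0 x joins the phase of the remaining coordinates, and what is left is the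
    one-dimensional formula. *)
Lemma integral_gaussian_rV_cos n (s y : 'I_n -> R) (t : R) : (forall i, 0 < s i) ->
  (\int[leb n]_x (gaussian_rV (fun=> 0%R) s x * cos (\sum_(i < n) y i * x ord0 i
    + t))%:E =
   (\prod_(i < n) (normal_peak (s i))^-1 *
    \prod_(i < n) expR (- (s i ^+ 2 * y i ^+ 2) / 2) * cos t)%:E)%E.
Proof.
elim: n s y t => [|n IH] s y t s0.
  rewrite !big_ord0 mulr1 mul1r.
  under eq_integral do rewrite /gaussian_rV !big_ord0 mul1r add0r.
  by rewrite integral_cst//= diracT mule1.
have sn0 i : s i != 0 by rewrite gt_eqF.
rewrite integral_rVS; last first.
  apply: (@integrable_gaussian_rV_cos _ (fun=> 0) s) => //.
  exact: measurable_linear_rV.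
pose A := \prod_(i < n) (normal_peak (s (lift ord0 i)))^-1.
pose B := \prod_(i < n) expR (- (s (lift ord0 i) ^+ 2 * y (lift ord0 i) ^+ 2) / 2).
transitivity (\int[mu]_x ((A * B)%:E * (normal_fun 0 (s ord0) x * cos (y ord0 * x
  + t))%:E))%E.
  apply: eq_integral => x _.
  transitivity (\int[leb n]_z ((normal_fun 0 (s ord0) x)%:E *
     (gaussian_rV (fun=> 0%R) (fun i => s (lift ord0 i)) z *
      cos (\sum_(i < n) y (lift ord0 i) * z ord0 i + (y ord0 * x + t)))%:E))%E.
    apply: eq_integral => z _; rewrite -EFinM mulrA; congr ((_ * cos _)%:E).
      exact: (prod_consrV (fun i => normal_fun 0 (s i))).
    rewrite big_ord_recl consrV0 addrAC [LHS]addrC; congr (_ + _).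
    by apply: eq_bigr => i _; rewrite consrVS.
  rewrite integralZl//; last first.
    apply: (@integrable_gaussian_rV_cos _ (fun=> 0) (fun i => s (lift ord0 i)))
      => //.
    exact: measurable_linear_rV.
  rewrite (IH (fun i => s (lift ord0 i)) (fun i => y (lift ord0 i)))//.
  by rewrite -!EFinM -/A -/B; congr EFin; ring.
have iC := integrable_normal_fun_cos (y ord0) t (sn0 ord0).
rewrite integralZl//.
rewrite (_ : (\int[mu]_x _)%E = (Rintegral mu setT
    (fun x => normal_fun 0 (s ord0) x * cos (y ord0 * x + t)))%:E); last first.
  by rewrite /Rintegral fineK//; exact: integrable_fin_num iC.
rewrite gaussian_cos// -EFinM !big_ord_recl -/A -/B; congr EFin.
ring.
Qed.

End lebesgue_rV_fubini.

(** * Schwartz functions *)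

Section directional_derivatives.
Context {R : realType} {n : nat}.
Implicit Types (f g : 'rV[R]_n -> R) (x v : 'rV[R]_n).

(** Directional derivatives alone obey no chain rule, so differentiability is carried along; the
    Schwartz condition asks for both anyway. *)
Definition has_derivative f x v (a : R) : Prop :=
  differentiable f x /\ is_derive x v f a.

Lemma has_derivative_eq f g x v a b :
  has_derivative f x v a -> f = g -> a = b -> has_derivative g x v b.
Proof. by move=> H <- <-. Qed.

Lemma has_derivative_cst c x v : has_derivative (fun=> c) x v 0.
Proof. by split; [exact: differentiable_cst|exact: is_derive_cst]. Qed.

Lemma has_derivative_coord i x v :
  has_derivative (fun y => y ord0 i) x v (v ord0 i).
Proof.
have dc : differentiable (fun y : 'rV[R]_n => y ord0 i) x.
  exact: (@differentiable_coord _ 1 n x ord0 i).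
split=> //; apply: DeriveDef; first exact: diff_derivable.
rewrite /derive; apply: cvg_lim => //; apply: cvg_near_cst; near=> h.
have h0 : h != 0 by near: h; exact: nbhs_dnbhs_neq.
by rewrite /= !mxE addrK /GRing.scale/= mulKf.
Unshelve. all: by end_near. Qed.

Lemma has_derivativeD f g x v a b : has_derivative f x v a ->
  has_derivative g x v b -> has_derivative (fun y => f y + g y) x v (a + b).
Proof.
move=> [df f'] [dg g']; split; first exact: differentiableD.
exact: is_deriveD.
Qed.

Lemma has_derivativeM f g x v a b : has_derivative f x v a ->
  has_derivative g x v b ->
  has_derivative (fun y => f y * g y) x v (a * g x + f x * b).
Proof.
move=> [df f'] [dg g']; split; first exact: differentiableM.
apply: is_derive_eq; rewrite /GRing.scale/=; ring.
Qed.

Lemma has_derivative_sum (I : Type) (r : seq I) (f : I -> 'rV[R]_n -> R) x v (a :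
  I -> R) :
  (forall i, has_derivative (f i) x v (a i)) ->
  has_derivative (fun y => \sum_(i <- r) f i y) x v (\sum_(i <- r) a i).
Proof.
move=> fa; elim: r => [|i r IH].
  apply: (has_derivative_eq (has_derivative_cst 0 x v)).
    by apply/funext => y; rewrite big_nil.
  by rewrite big_nil.
apply: (has_derivative_eq (has_derivativeD (fa i) IH)).
  by apply/funext => y; rewrite big_cons.
by rewrite big_cons.
Qed.

Lemma has_derivative_comp (h : R -> R) f x v a b : has_derivative f x v a ->
  is_derive (f x) 1 h b -> has_derivative (h \o f) x v (b * a).
Proof.
move=> [df f'] h'.
have dh : differentiable h (f x) by apply/derivable1_diffP; exact: ex_derive.
have dhf : differentiable (h \o f) x by exact: differentiable_comp.
split => //; apply: DeriveDef; first exact: diff_derivable.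
rewrite deriveE// diff_comp//=.
have -> : 'd f x v = a by rewrite -deriveE// derive_val.
rewrite -[X in 'd h _ X]mulr1 -[_ * 1]/(_ *: (1 : R^o)) linearZ/=.
by rewrite -deriveE// derive_val mulrC.
Qed.

End directional_derivatives.

Section euclidean_norm.
Context {R : realType} {n : nat}.
Implicit Types (x : 'rV[R]_n).

Lemma sum_le_prod (a : 'I_n -> R) : (forall i, 0 <= a i) ->
  1 + \sum_(i < n) a i <= \prod_(i < n) (1 + a i).
Proof.
move=> a0; suff [] : 0 <= \sum_(i < n) a i /\ 1 + \sum_(i < n) a i <= \prod_(i <
  n) (1 + a i) by [].
apply: (big_ind2 (fun (u w : R) => 0 <= u /\ 1 + u <= w)).
- by rewrite addr0.
- move=> u1 w1 u2 w2 [u10 H1] [u20 H2]; split; first exact: addr_ge0.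
  apply: (@le_trans _ _ ((1 + u1) * (1 + u2))); first by nra.
  by apply: ler_pM => //; rewrite addr_ge0.
- by move=> i _.
Qed.

Lemma enorm_le_sum x : enorm x <= \sum_(i < n) `|x ord0 i|.
Proof.
have S0 : 0 <= \sum_(i < n) `|x ord0 i| by exact: sumr_ge0.
rewrite /enorm -[leRHS]ger0_norm// -sqrtr_sqr ler_wsqrtr// /dotrV.
suff [] : 0 <= \sum_(i < n) `|x ord0 i| /\
    \sum_(i < n) x ord0 i * x ord0 i <= (\sum_(i < n) `|x ord0 i|) ^+ 2 by [].
apply: (big_ind2 (fun (u w : R) => 0 <= u /\ w <= u ^+ 2)).
- by rewrite expr0n.
- move=> u1 w1 u2 w2 [u10 H1] [u20 H2]; split; first exact: addr_ge0.
  nra.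
- by move=> i _; rewrite real_normK ?num_real// expr2.
Qed.

Lemma enorm_ge0 x : 0 <= enorm x. Proof. exact: sqrtr_ge0. Qed.

Lemma coord_le_enorm x i : `|x ord0 i| <= enorm x.
Proof.
rewrite -sqrtr_sqr ler_wsqrtr// /dotrV (bigD1 i)//= -expr2 lerDl.
by apply: sumr_ge0 => j _; rewrite -expr2 sqr_ge0.
Qed.

Lemma enorm_le_prod x : 1 + enorm x <= \prod_(i < n) (1 + `|x ord0 i|).
Proof.
apply: le_trans (sum_le_prod (fun i => normr_ge0 (x ord0 i))).
by rewrite lerD2l enorm_le_sum.
Qed.

End euclidean_norm.

Section schwartz_gaussian.
Context {R : realType} {n : nat}.
Variables (s y : 'I_n -> R).
Hypothesis s0 : forall i, s i != 0.
Implicit Types (x : 'rV[R]_n).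

(** The phase t keeps the family closed under differentiation: the sine produced by the cosine is
    again a cosine, with t shifted by pi / 2. *)
Definition wave_packet (t : R) x : R :=
  gaussian_rV (fun=> 0) s x * cos (\sum_(i < n) y i * x ord0 i + t).

(** A class containing the wave packets and closed under derivatives and under multiplication by
    coordinates. Induction on membership yields the Schwartz property without formulas for iterated
    derivatives. *)
Inductive polynomial_wave_packet : ('rV[R]_n -> R) -> Prop :=
| Pwp_base t : polynomial_wave_packet (wave_packet t)
| Pwp_add f g : polynomial_wave_packet f -> polynomial_wave_packet g ->
    polynomial_wave_packet (fun x => f x + g x)
| Pwp_scale c f : polynomial_wave_packet f ->
    polynomial_wave_packet (fun x => c * f x)
| Pwp_coord i f : polynomial_wave_packet f ->
    polynomial_wave_packet (fun x => x ord0 i * f x).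

Lemma has_derivative_wave_packet (t : R) x v :
  has_derivative (wave_packet t) x v
    (\sum_(i < n) (- (v ord0 i / s i ^+ 2)) * (x ord0 i * wave_packet t x) +
     - (\sum_(i < n) y i * v ord0 i) * wave_packet (t - pi / 2) x).
Proof.
pose q x := \sum_(i < n) (- (2 * s i ^+ 2)^-1) * (x ord0 i * x ord0 i).
pose L x := \sum_(i < n) y i * x ord0 i + t.
have dq : has_derivative q x v (\sum_(i < n) (- (v ord0 i / s i ^+ 2)) * x ord0 i).
  apply: (has_derivative_eq (has_derivative_sum _ (fun i =>
    has_derivativeM (has_derivative_cst (- (2 * s i ^+ 2)^-1) x v)
     (has_derivativeM (has_derivative_coord i x v) (has_derivative_coord i x
       v))))) => //.
  by apply: eq_bigr => i _; field.
have dL : has_derivative L x v (\sum_(i < n) y i * v ord0 i).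
  apply: (has_derivative_eq (has_derivativeD (has_derivative_sum _ (fun i =>
    has_derivativeM (has_derivative_cst (y i) x v) (has_derivative_coord i x v)))
    (has_derivative_cst t x v))) => //.
  by rewrite addr0; apply: eq_bigr => i _; rewrite mul0r add0r.
have E : gaussian_rV (fun=> 0) s = expR \o q.
  apply/funext => z; rewrite /gaussian_rV /q /= expR_sum; apply: eq_bigr => i _.
  by rewrite /normal_fun; congr expR; rewrite subr0 -mulr_natr; field.
have dG : has_derivative (gaussian_rV (fun=> 0) s) x v
    (gaussian_rV (fun=> 0) s x * \sum_(i < n) (- (v ord0 i / s i ^+ 2)) * x ord0 i).
  rewrite E; exact: (has_derivative_comp dq (is_derive_expR _)).
apply: (has_derivative_eq (has_derivativeM dG (has_derivative_comp dL
  (is_derive_cos _)))) => //.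
rewrite /wave_packet /= addrA cosB cos_pihalf sin_pihalf mulr0 add0r mulr1 -/(L x).
congr (_ + _); last by ring.
rewrite mulr_sumr mulr_suml; apply: eq_bigr => i _; ring.
Qed.

Lemma polynomial_wave_packet_sum (I : Type) (r : seq I) (f : I -> 'rV[R]_n -> R) :
  (forall i, polynomial_wave_packet (f i)) ->
  polynomial_wave_packet (fun x => \sum_(i <- r) f i x).
Proof.
move=> Hf; elim: r => [|i r IH].
  have -> : (fun x => \sum_(i <- [::]) f i x) = (fun x => 0 * wave_packet 0 x).
    by apply/funext => x; rewrite big_nil mul0r.
  exact/Pwp_scale/Pwp_base.
have -> : (fun x => \sum_(j <- i :: r) f j x) = (fun x => f i x + \sum_(j <- r) f
  j x).
  by apply/funext => x; rewrite big_cons.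
exact: Pwp_add.
Qed.

Lemma polynomial_wave_packet_derivative f : polynomial_wave_packet f ->
  forall v, exists2 g, polynomial_wave_packet g & forall x, has_derivative f x v
    (g x).
Proof.
elim=> [t|{}f g _ IHf _ IHg|c {}f _ IHf|i {}f Hf IHf] v.
- eexists; last by move=> x; exact: has_derivative_wave_packet.
  apply: Pwp_add; last exact/Pwp_scale/Pwp_base.
  by apply: polynomial_wave_packet_sum => i; apply/Pwp_scale/Pwp_coord/Pwp_base.
- have [f' Hf' df] := IHf v; have [g' Hg' dg] := IHg v.
  exists (fun x => f' x + g' x); first exact: Pwp_add.
  by move=> x; exact: has_derivativeD.
- have [f' Hf' df] := IHf v.
  exists (fun x => c * f' x); first exact: Pwp_scale.
  move=> x; apply: (has_derivative_eq (has_derivativeM (has_derivative_cst c x v)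
    (df x))) => //.
  by rewrite mul0r add0r.
- have [f' Hf' df] := IHf v.
  exists (fun x => v ord0 i * f x + x ord0 i * f' x).
    by apply: Pwp_add; [exact: Pwp_scale|exact: Pwp_coord].
  by move=> x; exact: (has_derivativeM (has_derivative_coord i x v) (df x)).
Qed.

(** The exponent [N] stays general in the induction: a coordinate factor costs one power of 1 + |x|,
    so its induction hypothesis is used at [N.+1]. For a bare packet, 1 + |x| is at most the product
    of the 1 + |x_i|, which reduces the bound to one variable. *)
Lemma polynomial_wave_packet_decay f : polynomial_wave_packet f ->
  forall N : nat, exists C : R, forall x, (1 + enorm x) ^+ N * `|f x| <= C.
Proof.
elim=> [t|{}f g _ IHf _ IHg|c {}f _ IHf|i {}f Hf IHf] N.
- have e0 i : 0 < (2 * s i ^+ 2)^-1 :> R.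
    by rewrite invr_gt0 mulr_gt0// exprn_even_gt0// s0.
  have /choice[C HC] : forall i, exists C : R, forall z, (1 + `|z|) ^+ N *
    normal_fun 0 (s i) z <= C.
    move=> i; have [C C0 HC] := exp_dominates_power N (e0 i).
    exists C => z; have := HC z.
    rewrite -(ler_pM2r (expR_gt0 (- ((2 * s i ^+ 2)^-1 * z ^+ 2)))).
    rewrite -[leRHS]mulrA -expRD subrr expR0 mulr1; apply: le_trans.
    have -> // : normal_fun 0 (s i) z = expR (- ((2 * s i ^+ 2)^-1 * z ^+ 2)).
    by rewrite /normal_fun; congr expR; rewrite subr0 -[_ *+ 2]mulr_natr; field.
  exists (\prod_(i < n) C i) => x; rewrite /wave_packet normrM.
  have g0 := ltW (gaussian_rV_gt0 (fun=> 0) s x).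
  apply: (@le_trans _ _ ((\prod_(i < n) (1 + `|x ord0 i|)) ^+ N * gaussian_rV
    (fun=> 0) s x)).
    apply: ler_pM.
    + by rewrite exprn_ge0// addr_ge0// enorm_ge0.
    + by apply: mulr_ge0.
    + rewrite lerXn2r ?enorm_le_prod// nnegrE ?addr_ge0 ?enorm_ge0//.
      by apply: prodr_ge0 => i _; rewrite addr_ge0.
    + by rewrite (ger0_norm g0) ler_piMr// cos_max.
  rewrite -prodrXl -big_split/=; apply: ler_prod => i _; rewrite HC andbT.
  by rewrite mulr_ge0 ?exprn_ge0 ?addr_ge0// normal_fun_ge0.
- have [C HC] := IHf N; have [D HD] := IHg N.
  exists (C + D) => x; apply: le_trans (lerD (HC x) (HD x)).
  by rewrite -mulrDr ler_wpM2l ?ler_normD// exprn_ge0// addr_ge0// enorm_ge0.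
- have [C HC] := IHf N; exists (`|c| * C) => x.
  by rewrite normrM mulrCA ler_wpM2l.
- have [C HC] := IHf N.+1; exists C => x; apply: le_trans (HC x).
  rewrite normrM mulrA ler_wpM2r// exprSr ler_wpM2l ?exprn_ge0 ?addr_ge0
    ?enorm_ge0//.
  by rewrite (le_trans (coord_le_enorm x i))// lerDr.
Qed.

Lemma schwartz_polynomial_wave_packet f : polynomial_wave_packet f ->
  schwartz_real f.
Proof.
move=> Hf l; have Hl : polynomial_wave_packet (iter_partial l f).
  elim: l => [//|i l IH]; have [g Hg dg] := polynomial_wave_packet_derivative IH
    (delta_mx ord0 i).
  suff -> : iter_partial (i :: l) f = g by [].
  by apply/funext => x; have [_ d] := dg x; rewrite /= derive_val.
split; last exact: polynomial_wave_packet_decay.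
(* The direction 0 is arbitrary: only the differentiability contained in [has_derivative] is
   extracted. *)
by move=> x; have [g _ dg] := polynomial_wave_packet_derivative Hl 0;
  have [] := dg x.
Qed.

End schwartz_gaussian.

(** * Propagation of Gaussian wave packets *)

Section gaussian_propagator.
Context {R : realType} {n : nat}.
Notation leb := (@lebesgue_rV R n).
Implicit Types (s a : 'I_n -> R) (x xi : 'rV[R]_n) (P : mpoly n R).

(** By the mean value theorem. A first-order bound suffices, since phase errors are only ever
    averaged against a Gaussian. *)
Lemma cos_ge1B (u : R) : 1 - `|u| <= cos u.
Proof.
wlog u0 : u / 0 <= u.
  move=> H; have [/H//|/ltW u0] := leP 0 u.
  by rewrite -normrN -cosN; apply: H; rewrite oppr_ge0.
rewrite ger0_norm//.
have [c _] := MVT_segment u0 (fun z _ => is_derive_cos z)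
  (continuous_subspaceT (@continuous_cos R)).
rewrite cos0 subr0 => E; have := sin_le1 c; nra.
Qed.

Lemma normal_peakV (m : R) : 0 < m -> (normal_peak m)^-1 = m * Num.sqrt (pi *+ 2).
Proof.
by move=> m0; rewrite /normal_peak invrK -mulrnAr sqrtrM ?sqr_ge0// sqrtr_sqr
  gtr0_norm.
Qed.

Definition gaussian_mass s : R := \prod_(i < n) (normal_peak (s i))^-1.

Lemma Rintegral_gaussian_rV a s : (forall i, s i != 0) ->
  \int[leb]_x gaussian_rV a s x = gaussian_mass s.
Proof. by move=> s0; rewrite /Rintegral integral_gaussian_rV. Qed.

Lemma gaussian_massE s : (forall i, 0 < s i) ->
  gaussian_mass s = \prod_(i < n) s i * Num.sqrt (pi *+ 2) ^+ n.
Proof.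
move=> s0; rewrite /gaussian_mass.
under eq_bigr do rewrite normal_peakV//.
by rewrite big_split/= prodr_const card_ord.
Qed.

Lemma gaussian_mass_gt0 s : (forall i, 0 < s i) -> 0 < gaussian_mass s.
Proof.
move=> s0; apply: prodr_gt0 => i _.
by rewrite invr_gt0 normal_peak_gt0// gt_eqF.
Qed.

(* The phase [- (pi / 2)] turns the cosine of a wave packet into a sine. *)
Definition gaussian_wave s a x : R[i] :=
  let k := (gaussian_mass (fun i => (s i)^-1))^-1 in
  ((k * wave_packet (fun i => (s i)^-1) a 0 x) +i*
   (k * wave_packet (fun i => (s i)^-1) a (- (pi / 2)) x))%C.

Lemma schwartz_gaussian_wave s a : (forall i, s i != 0) ->
  schwartz (gaussian_wave s a).
Proof.
move=> s0; have sV0 i : (s i)^-1 != 0 by rewrite invr_eq0.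
by split; apply: (schwartz_polynomial_wave_packet sV0 (y := a));
  exact/Pwp_scale/Pwp_base.
Qed.

Lemma fourier_gaussian_wave s a xi : (forall i, 0 < s i) ->
  fourier (gaussian_wave s a) xi = (gaussian_rV a s xi)%:C%C.
Proof.
move=> s0; have sV0 i : 0 < (s i)^-1 by rewrite invr_gt0.
have sVn0 i : (s i)^-1 != 0 by rewrite gt_eqF.
pose k := (gaussian_mass (fun i => (s i)^-1))^-1.
(* For t = 0 this is the real part of the Fourier integral; for t = - pi / 2 it is the imaginary
   part, which vanishes. The prefactor k cancels the mass of the Gaussian of widths 1 / s_i. *)
have H t : \int[leb]_x (k * (gaussian_rV (fun=> 0) (fun i => (s i)^-1) x *
    cos (\sum_(i < n) (a i - xi ord0 i) * x ord0 i + t))) = gaussian_rV a s xi *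
      cos t.
  rewrite RintegralZl//; last first.
    by apply: integrable_gaussian_rV_cos => //; exact: measurable_linear_rV.
  rewrite /Rintegral integral_gaussian_rV_cos//= -/(gaussian_mass (fun i => (s
    i)^-1)).
  rewrite /k -mulrA mulKf ?gt_eqF ?gaussian_mass_gt0//; congr (_ * _).
  apply: eq_bigr => i _; rewrite /normal_fun; congr expR.
  by rewrite -[_ *+ 2]mulr_natr; field; rewrite gt_eqF.
have L x : \sum_(i < n) (a i - xi ord0 i) * x ord0 i =
    \sum_(i < n) a i * x ord0 i + - dotrV x xi.
  rewrite /dotrV -sumrN -big_split/=; apply: eq_bigr => i _; ring.
rewrite /fourier /Cintegral /gaussian_wave -/k; congr (_ +i* _)%C.
  transitivity (gaussian_rV a s xi * cos 0); last by rewrite cos0 mulr1.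
  rewrite -(H 0); apply: eq_Rintegral => x _ /=.
  rewrite L /wave_packet !addr0 !cosD [cos (- (pi / 2))]cosN [sin (- (pi / 2))]sinN.
  rewrite cos_pihalf sin_pihalf; ring.
transitivity (gaussian_rV a s xi * cos (- (pi / 2))).
  rewrite -(H (- (pi / 2))); apply: eq_Rintegral => x _ /=.
  rewrite L /wave_packet !addr0 !cosD !sinD [cos (- (pi / 2))]cosN [sin (- (pi /
    2))]sinN.
  rewrite cos_pihalf sin_pihalf; ring.
by rewrite cosN cos_pihalf mulr0.
Qed.

Lemma measurable_dotrV x : measurable_fun [set: 'rV[R]_n] (fun xi => dotrV x xi).
Proof.
by apply: measurable_sum => i; apply: measurable_funM => //;
  exact: measurable_coord_rV.
Qed.

Lemma measurable_meval P :
  measurable_fun [set: 'rV[R]_n] (fun xi : 'rV[R]_n => meval (fun i => xi ord0 i)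
    P).
Proof.
under eq_fun do rewrite mevalE.
apply: measurable_sum => m; apply: measurable_funM => //.
by apply: measurable_prod => i _; apply: measurable_funX;
  exact: measurable_coord_rV.
Qed.

(** Any constant phase theta can be removed before taking the modulus, and then cos u >= 1 - |u|
    turns a phase error that is small on average into a lower bound. The wider Gaussian in the
    hypothesis leaves room for errors growing polynomially in the frequency. *)
Lemma normc_propagator_gaussian_wave P (t : R) x s a (theta eta : R) :
  (forall i, 0 < s i) ->
  (forall xi, gaussian_rV a s xi *
     `|dotrV x xi + meval (fun i => xi ord0 i) P * t - theta| <=
     eta * gaussian_rV a (fun i => Num.sqrt 2 * s i) xi) ->
  (2 * pi) ^- n * (1 - eta * Num.sqrt 2 ^+ n) * gaussian_mass s <=
  Normc.normc (propagator P t (gaussian_wave s a) x).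
Proof.
move=> s0 Hphase; set g := gaussian_rV a s in Hphase *.
have sn0 i : s i != 0 by rewrite gt_eqF.
pose Phi xi := dotrV x xi + meval (fun i => xi ord0 i) P * t.
have mPhi : measurable_fun [set: 'rV[R]_n] Phi.
  apply: measurable_funD; first exact: measurable_dotrV.
  by apply: measurable_funM => //; exact: measurable_meval.
have iG c : leb.-integrable [set: 'rV[R]_n] (EFin \o (fun xi => g xi * cos (Phi
  xi + c))).
  by apply: integrable_gaussian_rV_cos => //; exact: measurable_funD.
(* Real and imaginary part of the integral; the sine is written as a shifted cosine so that [iG]
   covers both. *)
pose A := \int[leb]_xi (g xi * cos (Phi xi + 0)).
pose B := \int[leb]_xi (g xi * cos (Phi xi + - (pi / 2))).
have -> : propagator P t (gaussian_wave s a) x = (((2 * pi) ^- n)%:C * (A +i* B))%C.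
  rewrite /propagator /Cintegral; congr (_ * (_ +i* _))%C;
    apply: eq_Rintegral => xi _; rewrite fourier_gaussian_wave//= -/g -/(Phi xi).
    by rewrite addr0; ring.
  by rewrite cosB cos_pihalf sin_pihalf; ring.
have p0 : 0 <= ((2 * pi) ^- n : R) by rewrite invr_ge0 exprn_ge0// mulr_ge0//
  pi_ge0.
rewrite Normc.normcM -mulrA.
have -> : Normc.normc ((2 * pi) ^- n)%:C%C = (2 * pi) ^- n :> R.
  by rewrite /Normc.normc /= expr0n/= addr0 sqrtr_sqr ger0_norm.
rewrite ler_wpM2l//.
(* The middle term is the real part of exp(- i theta) (A + i B), hence at most the modulus of A + i
   B. *)
apply: (@le_trans _ _ (A * cos theta + B * sin theta)); last first.
  rewrite /= -[leLHS]mulr1.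
  apply: le_trans (ler_norm _) _; rewrite mulr1 -sqrtr_sqr ler_wsqrtr//.
  have := cos2Dsin2 theta; have := sqr_ge0 (A * sin theta - B * cos theta); nra.
have -> : A * cos theta + B * sin theta = \int[leb]_xi (g xi * cos (Phi xi + -
  theta)).
  rewrite /A /B -!RintegralZr// -RintegralD//; last 2 first.
  - by have := integrableZr measurableT (cos theta) (iG 0); apply: eq_integrable.
  - by have := integrableZr measurableT (sin theta) (iG (- (pi / 2)));
      apply: eq_integrable.
  apply: eq_Rintegral => xi _.
  by rewrite addr0 !cosB cos_pihalf sin_pihalf; ring.
pose g2 := gaussian_rV a (fun i => Num.sqrt 2 * s i).
have s2 i : 0 < Num.sqrt 2 * s i by rewrite mulr_gt0// sqrtr_gt0.
have s2n0 i : Num.sqrt 2 * s i != 0 by rewrite gt_eqF.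
have ig2 : leb.-integrable [set: 'rV[R]_n] (EFin \o (fun xi => eta * g2 xi)).
  by have := integrableZl measurableT eta (integrable_gaussian_rV a s2n0);
    apply: eq_integrable.
have ig := integrable_gaussian_rV a sn0.
apply: (@le_trans _ _ (\int[leb]_xi (g xi - eta * g2 xi))).
  rewrite RintegralB// RintegralZl//; last exact: integrable_gaussian_rV.
  rewrite !Rintegral_gaussian_rV// !gaussian_massE//.
  by rewrite big_split/= prodr_const card_ord; rewrite le_eqVlt; apply/orP; left;
    apply/eqP; ring.
apply: le_Rintegral => //.
- by have := integrableB measurableT ig ig2; apply: eq_integrable.
- move=> xi _; apply: le_trans (lerB (lexx _) (Hphase xi)) _.
  rewrite -[X in X - _]mulr1 -mulrBr ler_wpM2l ?cos_ge1B//.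
  exact/ltW/gaussian_rV_gt0.
Qed.

End gaussian_propagator.

(** * Polynomial estimates *)

Section nonvanishing_point.
Context {R : realType} {n : nat}.
Implicit Types (p : mpoly n R) (S : {set 'I_n}) (m : multinom n).

Lemma poly_nonroot (F : {poly R}) : F != 0 -> exists T : R, F.[T] != 0.
Proof.
move=> F0; apply: contrapT => H.
pose rs := [seq i%:R | i <- iota 0 (size F)] : seq R.
have : (size rs < size F)%N.
  apply: max_poly_roots => //.
    apply/allP => T _; rewrite /root; apply: contrapT => /negP FT.
    by apply: H; exists T.
  rewrite map_inj_uniq ?iota_uniq// => i j /eqP.
  by rewrite eqr_nat => /eqP.
by rewrite size_map size_iota ltnn.
Qed.

(** Feeds the Kronecker substitution below: exponents smaller than B are the base B digits of the
    weight of their monomial. *)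
Lemma digits_inj (B k : nat) (u v : 'I_k -> nat) :
  (forall i, u i < B)%N -> (forall i, v i < B)%N ->
  (\sum_(i < k) u i * B ^ i = \sum_(i < k) v i * B ^ i)%N -> u =1 v.
Proof.
elim: k u v => [|k IH] u v uB vB; first by move=> _ [].
have sumE (t : 'I_k.+1 -> nat) : (\sum_(i < k.+1) t i * B ^ i =
    (\sum_(i < k) t (lift ord0 i) * B ^ i) * B + t ord0)%N.
  rewrite big_ord_recl expn0 muln1 addnC; congr (_ + _)%N.
  by rewrite big_distrl/=; apply: eq_bigr => i _; rewrite -mulnA -expnSr.
rewrite !sumE => E.
have B0 : (0 < B)%N by exact: leq_ltn_trans (uB ord0).
have E0 : u ord0 = v ord0.
  have := congr1 (fun z => z %% B)%N E; rewrite !modnMDl.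
  by rewrite !modn_small.
have ES : u \o lift ord0 =1 v \o lift ord0.
  apply: IH => //=.
  by have := congr1 (fun z => z %/ B)%N E; rewrite !divnMDl// !divn_small// !addn0.
by move=> i; case: (unliftP ord0 i) => [j|] ->; [exact: (ES j)|exact: E0].
Qed.

(* Kronecker substitution: for a large base [B], the choice [w i = T ^+ (B ^ i)]
   sends distinct monomials of [p] to distinct powers of [T]. *)
Lemma mpoly_nonvanishing p S m0 : m0 \in msupp p -> monomial_in S m0 ->
  exists w : 'I_n -> R, (forall i, i \notin S -> w i = 0) /\ meval w p != 0.
Proof.
(* [mmeasure mdeg p] is one more than the degree of p, hence larger than every exponent occurring in
   p. *)
move=> m0p m0S; pose B := mmeasure mdeg p.
pose wt m := (\sum_(i < n) m i * B ^ i)%N.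
have mB m : m \in msupp p -> forall i, (m i < B)%N.
  move=> mp i; apply: (@leq_ltn_trans (mdeg m)); last exact: mmeasure_mnm_lt.
  by rewrite mdegE (bigD1 i)//= leq_addr.
pose ok m := [forall i, (i \notin S) ==> (m i == 0%N)].
pose F : {poly R} := \sum_(m <- msupp p | ok m) mcoeff m p *: 'X^(wt m).
have okm0 : ok m0 by apply/forallP => i; apply/implyP => /m0S ->.
have F0 : F != 0.
  apply/eqP => /(congr1 (fun q : {poly R} => q`_(wt m0))).
  rewrite coef0 /F coef_sum big_mkcond (bigD1_seq m0)//=.
  rewrite okm0 coefZ coefXn eqxx mulr1 big1_seq ?addr0.
    by apply/eqP; rewrite -mcoeff_msupp.
  move=> m /andP[mm0 mp]; case: ifP => // _; rewrite coefZ coefXn.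
  case: eqVneq => [E|_]; last by rewrite mulr0.
  exfalso; move/eqP: mm0; apply; apply/mnmP.
  by move=> i; rewrite (@digits_inj B n m m0)//; exact: mB.
have [T FT] := poly_nonroot F0.
exists (fun i => if i \in S then T ^+ (B ^ i) else 0); split.
  by move=> i /negbTE ->.
suff -> : meval (fun i => if i \in S then T ^+ (B ^ i) else 0) p = F.[T] by [].
rewrite mevalE /F horner_sum [RHS]big_mkcond/=; apply: eq_bigr => m _.
case: ifPn => [/forallP okm|].
  rewrite hornerZ hornerXn /wt; congr (_ * _).
  rewrite -prodrXr; apply: eq_bigr => i _; case: ifPn => [_|iS].
    by rewrite -exprM mulnC.
  by have := okm i; rewrite iS/= => /eqP ->; rewrite mul0n !expr0.
move=> /forallPn[j]; rewrite negb_imply => /andP[jS mj].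
by rewrite (bigD1 j)//= (negbTE jS) expr0n (negbTE mj) mul0r mulr0.
Qed.

End nonvanishing_point.

(** * Calculus of growth rates in N *)

Section growth.
Context {R : realType} {n : nat}.
Implicit Types (h : R -> ('I_n -> R) -> R) (v w : 'I_n -> R) (N : R).

(** A product rather than a norm, so that it factors over the coordinates in the same way as the
    Gaussian. *)
Definition weight v : R := \prod_(i < n) (1 + `|v i|).

(* [h N v] is [O(N ^ M)] as [N -> +oo], up to a power of the weight of [v]. *)
Definition growth (M : nat) h : Prop := exists (C : R) (K : nat), 0 <= C /\
  forall N v, 1 <= N -> `|h N v| <= C * N ^+ M * weight v ^+ K.

Lemma weight_ge1 v : 1 <= weight v.
Proof.
rewrite /weight; elim/big_ind: _ => // [u1 u2 H1 H2|i _]; last by rewrite lerDl.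
by rewrite -[1]mulr1; apply: ler_pM.
Qed.

Lemma weight_gt0 v : 0 < weight v.
Proof. exact: lt_le_trans (weight_ge1 v). Qed.

Lemma coord_le_weight v i : `|v i| <= weight v.
Proof.
have -> : weight v = (1 + `|v i|) * \prod_(j < n | j != i) (1 + `|v j|).
  by rewrite /weight (bigD1 i).
apply: (@le_trans _ _ (1 + `|v i|)); first by rewrite lerDr.
rewrite ler_peMr ?addr_ge0//.
by elim/big_ind: _ => // [u1 u2 H1 H2|j _]; [rewrite -[1]mulr1;
  apply: ler_pM|rewrite lerDl].
Qed.

Lemma weight_power_mono v K K' : (K <= K')%N -> weight v ^+ K <= weight v ^+ K'.
Proof. by move=> KK; apply: ler_weXn2l => //; exact: weight_ge1. Qed.

Lemma growth_eq M h h' : growth M h -> (forall N v, 1 <= N -> h N v = h' N v) ->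
  growth M h'.
Proof.
move=> [C [K [C0 HC]]] E; exists C, K; split => // N v N1.
by rewrite -E//; exact: HC.
Qed.

Lemma growth_le M M' h : growth M h -> (M <= M')%N -> growth M' h.
Proof.
move=> [C [K [C0 HC]]] MM; exists C, K; split => // N v N1.
apply: le_trans (HC N v N1) _.
apply: ler_wpM2r; first by rewrite exprn_ge0// ltW// weight_gt0.
by apply: ler_wpM2l => //; exact: ler_weXn2l.
Qed.

Lemma growth_cst c : growth 0 (fun _ _ => c).
Proof.
exists `|c|, 0%N; split => // N v _.
by rewrite !expr0 !mulr1.
Qed.

Lemma growth_coord i : growth 0 (fun _ v => v i).
Proof.
exists 1, 1%N; split => // N v _.
by rewrite expr0 expr1 !mul1r coord_le_weight.
Qed.

Lemma growth_pow e : growth e (fun N _ => N ^+ e).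
Proof.
exists 1, 0%N; split => // N v N1.
by rewrite expr0 mulr1 mul1r ger0_norm// exprn_ge0// (le_trans ler01).
Qed.

Lemma growthM M M' h h' : growth M h -> growth M' h' ->
  growth (M + M') (fun N v => h N v * h' N v).
Proof.
move=> [C [K [C0 HC]]] [C' [K' [C'0 HC']]]; exists (C * C'), (K + K')%N.
split; first exact: mulr_ge0.
move=> N v N1; rewrite normrM.
apply: le_trans (ler_pM (normr_ge0 _) (normr_ge0 _) (HC N v N1) (HC' N v N1)) _.
by rewrite !exprD le_eqVlt; apply/orP; left; apply/eqP; ring.
Qed.

Lemma growthD M h h' : growth M h -> growth M h' ->
  growth M (fun N v => h N v + h' N v).
Proof.
move=> [C [K [C0 HC]]] [C' [K' [C'0 HC']]]; exists (C + C'), (maxn K K').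
split; first exact: addr_ge0.
move=> N v N1; apply: le_trans (ler_normD _ _) _.
have N0 : 0 <= N ^+ M by rewrite exprn_ge0// (le_trans ler01).
rewrite !mulrDl; apply: lerD.
  apply: le_trans (HC N v N1) _; apply: ler_wpM2l; first exact: mulr_ge0.
  by apply: weight_power_mono; exact: leq_maxl.
apply: le_trans (HC' N v N1) _; apply: ler_wpM2l; first exact: mulr_ge0.
by apply: weight_power_mono; exact: leq_maxr.
Qed.

Lemma growth_sum M (I : Type) (r : seq I) (Q : pred I) (h : I -> R -> ('I_n -> R)
  -> R) :
  (forall i, Q i -> growth M (h i)) ->
  growth M (fun N v => \sum_(i <- r | Q i) h i N v).
Proof.
move=> H; elim: r => [|i r IH].
  apply: (growth_eq (growth_le (growth_cst 0) (leq0n M))) => N v _.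
  by rewrite big_nil.
case Qi: (Q i); last by apply: (growth_eq IH) => N v _; rewrite big_cons Qi.
by apply: (growth_eq (growthD (H i Qi) IH)) => N v _; rewrite big_cons Qi.
Qed.

Lemma growth_exp M e h : growth M h -> growth (M * e) (fun N v => h N v ^+ e).
Proof.
move=> H; elim: e => [|e IH].
  by rewrite muln0; apply: (growth_eq (growth_cst 1)) => N v _; rewrite expr0.
by rewrite mulnS; apply: (growth_eq (growthM H IH)) => N v _; rewrite exprS.
Qed.

Lemma growth_prod (I : Type) (r : seq I) (M : I -> nat) (h : I -> R -> ('I_n ->
  R) -> R) :
  (forall i, growth (M i) (h i)) ->
  growth (\sum_(i <- r) M i) (fun N v => \prod_(i <- r) h i N v).
Proof.
move=> H; elim: r => [|i r IH].
  by rewrite big_nil; apply: (growth_eq (growth_cst 1)) => N v _; rewrite big_nil.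
by rewrite big_cons; apply: (growth_eq (growthM (H i) IH)) => N v _;
  rewrite big_cons.
Qed.

(** Turns the multiplied estimates of [growth_close] below back into bounds on the increments
    themselves. *)
Lemma growth_divX a M h : growth (M + a) (fun N v => N ^+ a * h N v) -> growth M h.
Proof.
move=> [C [K [C0 HC]]]; exists C, K; split => // N v N1.
have Na0 : 0 < N ^+ a by rewrite exprn_gt0// (lt_le_trans ltr01).
have := HC N v N1; rewrite normrM (ger0_norm (ltW Na0)) => H.
rewrite -(ler_pM2l Na0); apply: le_trans H _.
by rewrite exprD le_eqVlt; apply/orP; left; apply/eqP; ring.
Qed.

Lemma growth_at0 M h : growth M h -> growth M (fun N _ => h N (fun=> 0)).
Proof.
move=> [C [K [C0 HC]]]; exists C, 0%N; split => // N v N1.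
apply: le_trans (HC N (fun=> 0) N1) _.
rewrite le_eqVlt; apply/orP; left; apply/eqP; rewrite expr0; congr (_ * _).
by rewrite /weight big1 ?expr1n// => i _; rewrite normr0 addr0.
Qed.

End growth.

Section polynomial_growth.
Context {R : realType} {n : nat}.
Variables (i1 : 'I_n) (w : 'I_n -> R) (a b : nat).
Hypotheses (w1 : w i1 = 0) (ba : (b <= a)%N).
Implicit Types (v : 'I_n -> R) (N : R) (p : mpoly n R) (m : multinom n).

Definition freq N v : 'I_n -> R := fun i =>
  N ^+ a * w i + (if i == i1 then N ^+ b else 1) * v i.

(** The exponent 0 where w vanishes is the point: there the frequency stays bounded, which controls
    the forms in the variables of Sigma. *)
Definition freq_growth i : nat :=
  if i == i1 then b else if w i == 0 then 0%N else a.

Lemma growth_freq i : growth (freq_growth i) (fun N v => freq N v i).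
Proof.
rewrite /freq_growth /freq; case: eqVneq => [->|ii1].
  rewrite -[b]addn0.
  apply: (growth_eq (growthM (growth_pow b) (growth_coord i1))) => N v _.
  by rewrite w1 mulr0 add0r addn0.
case: eqVneq => [wi|wi].
  apply: (growth_eq (growth_coord i)) => N v _.
  by rewrite wi mulr0 add0r mul1r.
apply: growthD.
  by rewrite -[X in growth X _]addn0; apply: (growthM (growth_pow a) (growth_cst
    (w i))).
apply: (growth_le _ (leq0n a)).
by apply: (growth_eq (growth_coord i)) => N v _; rewrite mul1r.
Qed.

Lemma growth_monomial m : growth (\sum_(i < n) freq_growth i * m i)
  (fun N v => \prod_(i < n) freq N v i ^+ m i).
Proof.
by apply: growth_prod => i; exact/growth_exp/growth_freq.
Qed.

Lemma growth_meval M p :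
  (forall m, m \in msupp p -> \sum_(i < n) freq_growth i * m i <= M)%N ->
  growth M (fun N v => meval (freq N v) p).
Proof.
move=> H.
apply: (@growth_eq _ _ _ (fun N v => \sum_(m <- msupp p | m \in msupp p)
    (mcoeff m p * \prod_(i < n) freq N v i ^+ m i))); last first.
  by move=> N v _; rewrite mevalE -big_seq.
apply: growth_sum => m mp; rewrite -[M]add0n.
apply: growthM; first exact: growth_cst.
exact: growth_le (growth_monomial m) (H m mp).
Qed.

Lemma growth_meval_homog e p : p \is ishomog1 e mdeg ->
  growth (a * e) (fun N v => meval (freq N v) p).
Proof.
move=> /dhomogP hp; apply: growth_meval => m /hp <-.
rewrite /= mdegE big_distrr/=; apply: leq_sum => i _.
by rewrite leq_mul2r; apply/orP; right; rewrite /freq_growth; case: ifP => // _;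
  case: ifP.
Qed.

Lemma growth_meval_vanish p : (forall m, m \in msupp p -> forall i, freq_growth i
  != 0%N -> m i = 0%N) ->
  growth 0 (fun N v => meval (freq N v) p).
Proof.
move=> H; apply: growth_meval => m mp; rewrite leqn0 sum_nat_eq0.
apply/forallP => i; apply/implyP => _; rewrite muln_eq0.
by case: eqVneq => //= fi; rewrite (H m mp i).
Qed.

(* The increment of [h] is smaller than [h] by a factor [N ^+ a]; multiplying
   instead of dividing avoids a subtraction of exponents. *)
Definition growth_close M (h : R -> ('I_n -> R) -> R) : Prop :=
  growth M h /\ growth M (fun N v => N ^+ a * (h N v - h N (fun=> 0))).

(** With h_0 and h'_0 the values at v = 0, h h' - h_0 h'_0 = (h - h_0) h' + h_0 (h' - h'_0), so the
    gain of N^a survives products. *)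
Lemma growth_closeM M M' h h' : growth_close M h -> growth_close M' h' ->
  growth_close (M + M') (fun N v => h N v * h' N v).
Proof.
move=> [Hh dh] [Hh' dh']; split; first exact: growthM.
apply: (growth_eq (growthD (growthM dh Hh') (growthM (growth_at0 Hh) dh'))) => N
  v _.
ring.
Qed.

Lemma growth_close_cst c : growth_close 0 (fun _ _ => c).
Proof.
split; first exact: growth_cst.
by apply: (growth_eq (growth_cst 0)) => N v _; rewrite subrr mulr0.
Qed.

Lemma growth_close_exp M e h : growth_close M h ->
  growth_close (M * e) (fun N v => h N v ^+ e).
Proof.
move=> H; elim: e => [|e IH]; first by rewrite muln0; exact: growth_close_cst.
rewrite mulnS.
have -> : (fun N v => h N v ^+ e.+1) = (fun N v => h N v * h N v ^+ e).
  by apply/funext => N; apply/funext => v; rewrite exprS.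
exact: growth_closeM.
Qed.

Lemma growth_close_prod (I : Type) (r : seq I) (M : I -> nat) (h : I -> R ->
  ('I_n -> R) -> R) :
  (forall i, growth_close (M i) (h i)) ->
  growth_close (\sum_(i <- r) M i) (fun N v => \prod_(i <- r) h i N v).
Proof.
move=> H; elim: r => [|i r IH].
  rewrite big_nil; have -> : (fun N v => \prod_(i <- [::]) h i N v) = (fun _ _ =>
    1).
    by apply/funext => N; apply/funext => v; rewrite big_nil.
  exact: growth_close_cst.
rewrite big_cons; have -> : (fun N v => \prod_(j <- i :: r) h j N v) =
    (fun N v => h i N v * \prod_(j <- r) h j N v).
  by apply/funext => N; apply/funext => v; rewrite big_cons.
exact: growth_closeM.
Qed.

(** The increment is v_i alone, of order 1 against N^a. For [i1] it would be N^b v_1, which is why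
    [growth_close_meval] only concerns forms free of X_1. *)
Lemma growth_close_freq i : i != i1 -> growth_close a (fun N v => freq N v i).
Proof.
move=> ii1; split.
  apply: growth_le (growth_freq i) _.
  by rewrite /freq_growth (negbTE ii1); case: ifP.
rewrite -[a in growth a _]addn0.
apply: (growth_eq (growthM (growth_pow a) (growth_coord i))) => N v _.
by rewrite /freq (negbTE ii1); ring.
Qed.

Lemma growth_close_meval e p : p \is ishomog1 e mdeg -> mpoly_in [set~ i1]%SET p ->
  growth_close (a * e) (fun N v => meval (freq N v) p).
Proof.
move=> /dhomogP hp p1.
suff H m : m \in msupp p -> growth_close (a * e) (fun N v => mcoeff m p *
  \prod_(i < n) freq N v i ^+ m i).
  split.
    apply: (@growth_eq _ _ _ (fun N v => \sum_(m <- msupp p | m \in msupp p)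
      (mcoeff m p * \prod_(i < n) freq N v i ^+ m i))); last first.
      by move=> N v _; rewrite mevalE -big_seq.
    by apply: growth_sum => m /H[].
  apply: (@growth_eq _ _ _ (fun N v => \sum_(m <- msupp p | m \in msupp p)
    (N ^+ a * (mcoeff m p * \prod_(i < n) freq N v i ^+ m i -
      mcoeff m p * \prod_(i < n) freq N (fun=> 0) i ^+ m i)))); last first.
    by move=> N v _; rewrite !mevalE -big_seq -mulr_sumr sumrB.
  by apply: growth_sum => m /H[].
move=> mp; rewrite -[(a * e)%N]add0n; apply: growth_closeM;
  first exact: growth_close_cst.
have -> : (a * e = \sum_(i < n) a * m i)%N by rewrite -(hp m mp) /= mdegE
  big_distrr.
apply: growth_close_prod => i; have [->|ii1] := eqVneq i i1.
  have -> : m i1 = 0%N by apply: (p1 m mp); rewrite !inE eqxx.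
  rewrite muln0; have -> : (fun N v => freq N v i1 ^+ 0) = (fun _ _ => 1).
    by apply/funext => N; apply/funext => v; rewrite expr0.
  exact: growth_close_cst.
exact/growth_close_exp/growth_close_freq.
Qed.

Lemma meval_homog e p (c : R) : p \is ishomog1 e mdeg ->
  meval (fun i => c * w i) p = c ^+ e * meval w p.
Proof.
move=> /dhomogP hp; rewrite !mevalE mulr_sumr big_seq [RHS]big_seq.
apply: eq_bigr => m mp; rewrite mulrCA; congr (_ * _).
under eq_bigr do rewrite exprMn.
rewrite big_split/= prodrXr; congr (_ ^+ _ * _).
by rewrite -(hp m mp) /= mdegE.
Qed.

End polynomial_growth.

Section phase_growth.
Context {R : realType} {n : nat}.

(** The allowed error N^(a (k - 1)) is the inverse of the size of the time to be chosen. After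
    multiplication by t, only the term linear in v_1, of size N^(b + a (k - 1)), can be large, and
    it is designed to cancel against x . xi. *)
Lemma growth_phase (i1 : 'I_n) (w : 'I_n -> R) (a b k d : nat) (Sigma : {set 'I_n})
    (P : mpoly n R) (Q : nat -> mpoly n R) :
  (2 <= k)%N -> (b <= a)%N -> (2 <= d <= k)%N ->
  mmeasure mdeg P = k.+1 ->
  (forall i, (i <= k)%N ->
     Q (k - i)%N \is ishomog1 (k - i)%N mdeg /\ mpoly_in [set~ i1]%SET (Q (k -
       i)%N)) ->
  pihomog mdeg k P =
    \sum_(i < k.+1) mpolyX R (mnm1 i1) ^+ i * Q (k - i)%N ->
  Sigma \proper [set~ i1]%SET ->
  (forall i, (2 <= i <= d - 1)%N -> mpoly_in Sigma (Q (k - i)%N)) ->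
  (forall i, (d <= i <= k)%N -> Q (k - i)%N = 0 \/ (b * i + a * (k - i) <= a * (k
    - 1))%N) ->
  (forall i, i \notin ([set~ i1] :\: Sigma)%SET -> w i = 0) ->
  growth (a * (k - 1)) (fun N v =>
    meval (freq i1 w a b N v) P - meval (freq i1 w a b N (fun=> 0)) P -
    N ^+ b * v i1 * (N ^+ (a * (k - 1)) * meval w (Q (k - 1)%N))).
Proof.
move=> k2 ba /andP[d2 dk] sP hQ PE Spr hS hd w0.
have w1 : w i1 = 0 by apply: w0; rewrite !inE eqxx andbF.
pose F N v := freq i1 w a b N v.
have F1 N v : F N v i1 = N ^+ b * v i1.
  by rewrite /F /freq eqxx w1 mulr0 add0r.
have F0 N : F N (fun=> 0) = (fun i => N ^+ a * w i).
  by apply/funext => i; rewrite /F /freq mulr0 addr0.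
have PkE N v : meval (F N v) (pihomog mdeg k P) =
    meval (F N v) (Q k) + N ^+ b * v i1 * meval (F N v) (Q (k - 1)%N) +
    \sum_(i < k.-1) (N ^+ b * v i1) ^+ i.+2 * meval (F N v) (Q (k - i.+2)%N).
  rewrite PE raddf_sum/=.
  under eq_bigr do rewrite mevalM rmorphXn /= mevalXU F1.
  case: (k) k2 => [//|[//|k'] _].
  rewrite big_ord_recl expr0 mul1r subn0 big_ord_recl expr1 addrA; congr (_ + _).
have PE' : P = \sum_(e < k) pihomog mdeg e P + pihomog mdeg k P.
  rewrite [LHS](@pihomog_partitionE _ _ mdeg k.+1 P) ?sP//.
  by rewrite big_ord_recr.
have Glow : growth (a * (k - 1)) (fun N v => meval (F N v) (\sum_(e < k) pihomog
  mdeg e P)).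
  apply: (@growth_eq _ _ _ (fun N v => \sum_(e < k) meval (F N v) (pihomog mdeg e
    P))).
    apply: growth_sum => e _.
    apply: growth_le (growth_meval_homog w1 ba (pihomogP mdeg e P)) _.
    by rewrite leq_mul2l; apply/orP; right; rewrite leq_subRL ?add1n// (leq_trans
      _ k2).
  by move=> N v _; rewrite raddf_sum.
have Gk : growth (a * (k - 1)) (fun N v => meval (F N v) (Q k) - meval (F N
  (fun=> 0)) (Q k)).
  have [h1 h2] := hQ 0%N (leq0n _); rewrite !subn0 in h1 h2.
  have [_ H] := growth_close_meval a b w1 h1 h2.
  (* Q_k itself is only O(N^(a k)); subtracting its value at v = 0 gains the missing factor N^a. *)
  apply: (@growth_divX _ _ a); rewrite addnC -mulnS subn1 prednK//; exact: ltnW.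
have Gk1 : growth (a * (k - 1)) (fun N v => N ^+ b * v i1 *
    (meval (F N v) (Q (k - 1)%N) - N ^+ (a * (k - 1)) * meval w (Q (k - 1)%N))).
  have [|h1 h2] := hQ 1%N; first exact: leq_trans k2.
  have [_ H] := growth_close_meval a b w1 h1 h2.
  (* N^(a - b) N^b = N^a is the factor gained by the increment of Q_{k-1}; this is where b <= a
     enters. *)
  apply: (@growth_divX _ _ (a - b)).
  apply: growth_le (leq_addr (a - b) _).
  apply: (growth_eq (growthM (growth_coord i1) H)) => N v _.
  rewrite -/(F N (fun=> 0)) F0 (meval_homog _ _ h1) -exprM -[in N ^+ a](subnK ba)
    exprD /F; ring.
have Gi (i : 'I_k.-1) : growth (a * (k - 1))
    (fun N v => (N ^+ b * v i1) ^+ i.+2 * meval (F N v) (Q (k - i.+2)%N)).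
  have ik : (i.+2 <= k)%N.
    by have := ltn_ord i; rewrite -[X in (_ < X)%N -> _]subn1 ltn_subRL add1n.
  have Gu : growth (b * i.+2) (fun (N : R) (v : 'I_n -> R) => (N ^+ b * v i1) ^+
    i.+2).
    apply: (@growth_exp _ _ _ _ (fun N v => N ^+ b * v i1)).
    by have := growthM (@growth_pow R n b) (growth_coord i1); rewrite addn0.
  have [dj|jd] := leqP d i.+2.
    have [|Q0|le] := hd i.+2; first by rewrite dj ik.
      apply: (growth_eq (growth_le (growth_cst 0) (leq0n _))) => N v _.
      by rewrite Q0 raddf0 mulr0.
    have [h1 _] := hQ _ ik.
    exact: growth_le (growthM Gu (growth_meval_homog w1 ba h1)) le.
  (* Here 2 <= [i.+2] < d. The form stays bounded because w vanishes on Sigma, and N^(b i.+2) is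
     small enough because b <= a and [i.+2] <= k - 1. *)
  have hv : mpoly_in Sigma (Q (k - i.+2)%N).
    by apply: hS; rewrite /= subn1 -ltnS prednK// (leq_trans _ d2).
  have Gv : growth 0 (fun N v => meval (F N v) (Q (k - i.+2)%N)).
    apply: (growth_meval_vanish w1) => m mQ l; rewrite /freq_growth.
    have [lS|lS] := boolP (l \in Sigma); last by move=> _; exact: hv lS.
    have /fintype.subsetP/(_ _ lS) := proper_sub Spr; rewrite !inE => /negbTE ->.
    by rewrite w0 ?eqxx// !inE lS.
  apply: growth_le (growthM Gu Gv) _; rewrite addn0.
  by apply: leq_mul => //; rewrite subn1 -ltnS prednK ?(leq_trans jd)//
    (leq_trans _ k2).
(* The forms of degree below k need no cancellation: their values at v and at 0 are each O(N^(a (k -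
   1))). *)
have GN := growthM (growth_cst (-1)) (growth_at0 Glow).
apply: (growth_eq (growthD (growthD (growthD Glow GN) Gk)
  (growthD Gk1 (growth_sum _ (fun i _ => Gi i))))) => N v _.
rewrite [in RHS]PE' ![in RHS]mevalD -!/(F _ _) !PkE.
rewrite [X in _ = _ - (_ + (_ + X)) - _]big1; last by move=> i _;
  rewrite mulr0 expr0n/= mul0r.
ring.
Qed.

End phase_growth.

(** * Estimates for concentrating packets *)

Section integral_lower_bound.
Import HBNNSimple.
Local Open Scope ereal_scope.

(* [F] need not be measurable, which matters for the maximal function, a
   supremum over uncountably many times. *)
Lemma ge_cst_integral d (T : measurableType d) (R : realType)
    (mu : {measure set T -> \bar R}) (D B : set T) (F : T -> \bar R) (c : R) :
  measurable B -> B `<=` D -> (0 <= c)%R -> (forall x, D x -> 0 <= F x) ->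
  (forall x, B x -> c%:E <= F x) -> c%:E * mu B <= \int[mu]_(x in D) F x.
Proof.
move=> mB BD c0 F0 cF.
pose h := scale_nnsfun (indic_nnsfun R mB) c0.
have hE x : h x = (c * \1_B x)%R by [].
have -> : c%:E * mu B = sintegral mu h.
  have := integral_nnsfun mu measurableT h; rewrite patch_setT => <-.
  under eq_integral do rewrite hE EFinM.
  rewrite ge0_integralZl_EFin// ?integral_indic ?setIT//.
  by apply/measurable_EFinP; exact: measurable_indic.
rewrite integral_mkcond ge0_integralTE; last exact: erestrict_ge0.
apply: ereal_sup_ubound => /=; exists h => // x.
rewrite hE indicE patchE; case: (boolP (x \in B)) => [/set_mem Bx|_].
  by rewrite mem_set ?mulr1 ?cF//; exact: BD.
by rewrite mulr0; case: ifPn => // /set_mem; exact: F0.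
Qed.

End integral_lower_bound.

Section boxes.
Context {R : realType} {n : nat}.
Notation leb := (@lebesgue_rV R n).

Definition box (l u : 'I_n -> R) : set 'rV[R]_n :=
  [set x | forall i, l i < x ord0 i < u i].

Lemma boxE (l u : 'I_n -> R) (x : 'rV[R]_n) :
  \1_(box l u) x = \prod_(i < n) \1_(`]l i, u i[%classic : set R) (x ord0 i) :> R.
Proof.
rewrite indicE; case: (boolP (x \in box l u)) => [/set_mem bx|/negP bx].
  by rewrite big1// => i _; rewrite indicE mem_set//= in_itv/= bx.
have : ~ box l u x by move=> ?; apply: bx; exact: mem_set.
move=> /existsNP[i /negP bi]; rewrite (bigD1 i)//= indicE memNset ?mul0r//=.
by rewrite in_itv/=; exact/negP.
Qed.

Lemma measurable_box (l u : 'I_n -> R) : measurable (box l u).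
Proof.
have -> : box l u = \bigcap_(i in [set: 'I_n]) ((fun x : 'rV[R]_n => x ord0 i)
  @^-1` `]l i, u i[%classic).
  apply/seteqP; split=> x /= H i => [_|]; first by rewrite /= in_itv/= H.
  by have := H i I; rewrite /= in_itv.
apply: fin_bigcap_measurable => // i _; rewrite -[X in measurable X]setTI.
exact: measurable_coord_rV.
Qed.

Lemma lebesgue_box (l u : 'I_n -> R) : (forall i, l i <= u i) ->
  leb (box l u) = (\prod_(i < n) (u i - l i))%:E.
Proof.
move=> lu; transitivity (\int[leb]_x (\1_(box l u) x)%:E)%E.
  by rewrite integral_indic ?setIT//; exact: measurable_box.
under eq_integral do rewrite boxE.
rewrite (@integral_prod_rV _ _ (fun i => \1_(`]l i, u i[%classic : set R)) (fun i
  => u i - l i))//.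
move=> i; rewrite integral_indic// setIT [LHS](lebesgue_measure_itv `]l i, u
  i[)/= lte_fin.
case: ltP => [//|ul]; have -> : u i = l i by apply/le_anti; rewrite lu ul.
by rewrite subrr.
Qed.

End boxes.

Section packet_weight.
Context {R : realType} {n : nat}.
Implicit Types (m s : 'I_n -> R) (xi : 'rV[R]_n).

Definition rescaled m s xi : 'I_n -> R := fun i => (xi ord0 i - m i) / s i.

(** Product over the coordinates of [normal_fun_power]; C depends on K and n only, so it serves all
    N at once. *)
Lemma weight_gaussian_rV (K : nat) : exists2 C : R, 0 < C &
  forall m s xi, (forall i, s i != 0) ->
    weight (rescaled m s xi) ^+ K * gaussian_rV m s xi <=
    C * gaussian_rV m (fun i => Num.sqrt 2 * s i) xi.
Proof.
have [C C0 HC] := @normal_fun_power R K.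
exists (C ^+ n); first exact: exprn_gt0.
move=> m s xi s0; rewrite /weight -prodrXl -big_split/=.
have -> : C ^+ n = \prod_(i < n) C by rewrite prodr_const card_ord.
rewrite -big_split/=; apply: ler_prod => i _; rewrite HC// andbT.
by rewrite mulr_ge0 ?exprn_ge0 ?addr_ge0// normal_fun_ge0.
Qed.

Lemma gaussian_mass_sqrt2 s : (forall i, 0 < s i) ->
  gaussian_mass (fun i => Num.sqrt 2 * s i) = Num.sqrt 2 ^+ n * gaussian_mass s.
Proof.
move=> s0; rewrite !gaussian_massE//; last by move=> i;
  rewrite mulr_gt0// sqrtr_gt0.
by rewrite big_split/= prodr_const card_ord mulrA.
Qed.

End packet_weight.

Section concentrating_packets.
Context {R : realType} {n : nat}.
Variables (i1 : 'I_n) (w : 'I_n -> R) (a b : nat).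
Implicit Types (N : R) (x xi : 'rV[R]_n) (P : mpoly n R).

Definition center N : 'I_n -> R := fun i => N ^+ a * w i.
Definition scale N : 'I_n -> R := fun i => if i == i1 then N ^+ b else 1.

Lemma scale_gt0 N i : 1 <= N -> 0 < scale N i.
Proof.
by move=> N1; rewrite /scale; case: ifP => // _;
  rewrite exprn_gt0// (lt_le_trans ltr01).
Qed.

Lemma scale_neq0 N i : 1 <= N -> scale N i != 0.
Proof. by move=> N1; rewrite gt_eqF// scale_gt0. Qed.

Lemma freq_rescaled N xi : 1 <= N ->
  freq i1 w a b N (rescaled (center N) (scale N) xi) = (fun i => xi ord0 i).
Proof.
move=> N1; apply/funext => i; rewrite /freq /rescaled -/(scale N i) -/(center N i).
by rewrite mulrCA divff ?scale_neq0// mulr1 addrC subrK.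
Qed.

Lemma freq0 N : freq i1 w a b N (fun=> 0) = center N.
Proof. by apply/funext => i; rewrite /freq mulr0 addr0. Qed.

Lemma gaussian_mass_scale N : 1 <= N ->
  gaussian_mass (scale N) = N ^+ b * Num.sqrt (pi *+ 2) ^+ n.
Proof.
move=> N1; rewrite gaussian_massE => [|i]; last exact: scale_gt0.
rewrite (bigD1 i1)//= /scale eqxx big1 ?mulr1// => i /negbTE -> //.
Qed.

(** Once t cancels x_1 N^b v_1, two errors remain: the x_i v_i with i <> 1, harmless as these widths
    are 1, and t times the remainder, where the factor N^M of the remainder cancels against t. *)
Lemma phase_bound P (M : nat) (q : R) : q != 0 ->
  growth M (fun N v =>
    meval (freq i1 w a b N v) P - meval (freq i1 w a b N (fun=> 0)) P -
    N ^+ b * v i1 * (N ^+ M * q)) ->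
  exists (C : R) (K : nat), 0 < C /\ forall N (delta t : R) x xi,
    1 <= N -> (forall i, `|x ord0 i| <= delta) ->
    t = - x ord0 i1 / (q * N ^+ M) ->
    `|dotrV x xi + meval (fun i => xi ord0 i) P * t -
      (\sum_(i < n) x ord0 i * center N i + meval (center N) P * t)| <=
    delta * C * weight (rescaled (center N) (scale N) xi) ^+ K.
Proof.
move=> q0 [C [K [C0 HC]]].
(* n bounds the sum of the x_i v_i, C / |q| bounds the remainder, and 1 makes the constant positive.
   The power [K.+1] dominates both the first and the K-th power of the weight. *)
exists (n%:R + C / `|q| + 1), K.+1; split.
  by rewrite ltr_wpDl// addr_ge0// divr_ge0.
move=> N delta t x xi N1 xd tE0.
set v := rescaled (center N) (scale N) xi.
have N0 : 0 < N ^+ M by rewrite exprn_gt0// (lt_le_trans ltr01).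
have Nn0 : N ^+ M != 0 by rewrite gt_eqF.
have d0 : 0 <= delta by exact: le_trans (xd i1).
have W1 := weight_ge1 v.
have HC' := HC N v N1; rewrite freq_rescaled// freq0 in HC'.
set E := (X in `|X| <= C * _ * _) in HC'.
have -> : dotrV x xi + meval (fun i => xi ord0 i) P * t -
    (\sum_(i < n) x ord0 i * center N i + meval (center N) P * t) =
    \sum_(i < n | i != i1) x ord0 i * v i + t * E.
  have -> : dotrV x xi = \sum_(i < n) x ord0 i * center N i +
      \sum_(i < n) x ord0 i * (scale N i * v i).
    rewrite /dotrV -big_split/=; apply: eq_bigr => i _; rewrite -mulrDr;
      congr (_ * _).
    by rewrite /v /rescaled mulrCA divff ?scale_neq0// mulr1 addrC subrK.
  have -> : \sum_(i < n) x ord0 i * (scale N i * v i) =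
      x ord0 i1 * (N ^+ b * v i1) + \sum_(i < n | i != i1) x ord0 i * v i.
    rewrite (bigD1 i1)//= {1}/scale eqxx; congr (_ + _).
    by apply: eq_bigr => i ii1; rewrite /scale (negbTE ii1) mul1r.
  have tE : t * (N ^+ b * v i1 * (N ^+ M * q)) = - (x ord0 i1 * (N ^+ b * v i1)).
    by rewrite tE0; field; rewrite q0 Nn0.
  rewrite /E 2!mulrBr tE; ring.
apply: le_trans (ler_normD _ _) _.
have vW i : `|v i| <= weight v by exact: coord_le_weight.
have H1 : `|\sum_(i < n | i != i1) x ord0 i * v i| <= delta * n%:R * weight v.
  apply: le_trans (ler_norm_sum _ _ _) _.
  apply: (@le_trans _ _ (\sum_(i < n) delta * weight v)); last first.
    by rewrite sumr_const card_ord -mulr_natr; rewrite le_eqVlt; apply/orP; left;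
      apply/eqP; ring.
  rewrite big_mkcond/=; apply: ler_sum => i _; case: ifP => _.
    by rewrite normrM ler_pM.
  by rewrite mulr_ge0// (le_trans ler01).
have H2 : `|t * E| <= delta * (C / `|q|) * weight v ^+ K.
  rewrite normrM tE0 normrM normrN normfV normrM (gtr0_norm N0).
  apply: (@le_trans _ _ (delta / (`|q| * N ^+ M) * (C * N ^+ M * weight v ^+ K))).
    apply: ler_pM => //; first by rewrite mulr_ge0// invr_ge0 mulr_ge0// ltW.
    by rewrite ler_wpM2r// ?xd// invr_ge0 mulr_ge0// ltW.
  rewrite le_eqVlt; apply/orP; left; apply/eqP; field.
  by rewrite normr_eq0 q0 Nn0.
apply: le_trans (lerD H1 H2) _.
have WK : weight v <= weight v ^+ K.+1 by exact: ler_eXnr.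
have WK' : weight v ^+ K <= weight v ^+ K.+1 by exact: weight_power_mono.
have W0 : 0 <= weight v ^+ K.+1 by rewrite exprn_ge0// (le_trans ler01).
rewrite !mulrDr mulr1 !mulrDl; apply: ler_wpDr; first exact: mulr_ge0.
apply: lerD; first by rewrite ler_wpM2l// mulr_ge0.
by rewrite ler_wpM2l// mulr_ge0// divr_ge0.
Qed.

Definition packet N : 'rV[R]_n -> R[i] := gaussian_wave (scale N) (center N).

Lemma maximal_function_packet P (M : nat) (q : R) : q != 0 ->
  growth M (fun N v =>
    meval (freq i1 w a b N v) P - meval (freq i1 w a b N (fun=> 0)) P -
    N ^+ b * v i1 * (N ^+ M * q)) ->
  exists (c : R) (l u : 'I_n -> R), [/\ 0 < c, forall i, l i < u i,
    box l u `<=` [set x | enorm x < 1] &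
    forall N x, 1 <= N -> box l u x ->
      ((c * N ^+ b)%:E <= maximal_function P (packet N) x)%E].
Proof.
move=> q0 G; have [C [K [C0 HC]]] := phase_bound q0 G.
have [C' C'0 HC'] := @weight_gaussian_rV R n K.
pose A : R := C * C' * Num.sqrt 2 ^+ n.
have s2 : 0 < Num.sqrt 2 :> R by rewrite sqrtr_gt0.
have A0 : 0 < A by rewrite !mulr_gt0// exprn_gt0.
have qn0 : 0 < `|q| by rewrite normr_gt0.
(* The three summands make delta = 1 / B small enough for three purposes: the box fits into the unit
   ball, |t| < 1, and the phase error costs at most half of the integral, A collecting the constants
   of that error. *)
pose B : R := n.+1%:R + 2 / `|q| + 2 * A.
have B0 : 0 < B by rewrite !addr_gt0// ?divr_gt0// mulr_gt0.
pose delta : R := B^-1.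
have d0 : 0 < delta by rewrite invr_gt0.
have dB : delta * B = 1 by rewrite mulVf// gt_eqF.
have dn : delta * n.+1%:R <= 1.
  by rewrite -[leRHS]dB ler_pM2l// /B -addrA lerDl addr_ge0// ?divr_ge0//
    mulr_ge0// ltW.
have dq : delta / `|q| <= 2^-1.
  have : delta * (2 / `|q|) <= 1.
    by rewrite -[leRHS]dB ler_pM2l// /B addrAC lerDr; apply: addr_ge0 => //;
      rewrite mulr_ge0// ltW.
  by rewrite mulrCA; lra.
have dA : delta * A <= 2^-1.
  have : delta * (2 * A) <= 1.
    by rewrite -[leRHS]dB ler_pM2l// /B lerDr addr_ge0// divr_ge0.
  by rewrite mulrCA; lra.
(* The box lies where x_1 has the sign opposite to q, so that t = - x_1 / (q N^M) is positive. *)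
pose l i : R := if (i == i1) && (0 < q) then - delta else 0.
pose u i : R := l i + delta.
have boxd x : box l u x -> forall i, `|x ord0 i| <= delta.
  move=> bx i; have := bx i; rewrite /u /l ler_norml.
  by case: ifP => _ /andP[]; rewrite ?add0r ?addNr => h1 h2; apply/andP; split; lra.
pose c : R := (2 * pi) ^- n * 2^-1 * Num.sqrt (pi *+ 2) ^+ n.
have p20 : 0 < Num.sqrt (pi *+ 2) :> R by rewrite sqrtr_gt0 mulrn_wgt0// pi_gt0.
have pi0 : 0 < ((2 * pi) ^- n : R) by rewrite invr_gt0 exprn_gt0// mulr_gt0//
  pi_gt0.
exists c, l, u; split.
- by rewrite !mulr_gt0// ?exprn_gt0// invr_gt0.
- by move=> i; rewrite /u ltrDl.
- move=> x bx /=; apply: le_lt_trans (enorm_le_sum x) _.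
  apply: (@le_lt_trans _ _ (\sum_(i < n) delta)).
    by apply: ler_sum => i _; exact: boxd.
  rewrite sumr_const card_ord -mulr_natr.
  by apply: lt_le_trans dn; rewrite ltr_pM2l// ltr_nat.
move=> N x N1 bx; pose t := - x ord0 i1 / (q * N ^+ M).
have NM1 : 1 <= N ^+ M by exact: exprn_ege1.
have t01 : (`]0, 1[%classic : set R) t.
  have tE : t = - (x ord0 i1 * q) / (q ^+ 2 * N ^+ M).
    by rewrite /t; field; rewrite q0 gt_eqF// (lt_le_trans ltr01).
  have t0 : 0 < t.
    rewrite tE divr_gt0//; last first.
      by apply: mulr_gt0; [rewrite exprn_even_gt0|exact: lt_le_trans ltr01 NM1].
    have := bx i1; rewrite /u /l eqxx/= oppr_gt0.
    case: (ltP 0 q) => [q_gt0|q_le0] /andP[lx xu].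
      by rewrite pmulr_llt0//; lra.
    by rewrite nmulr_llt0// lt_neqAle q0.
  rewrite /= in_itv/= t0/=.
  apply: (@le_lt_trans _ _ `|t|); first exact: ler_norm.
  rewrite /t normrM normrN normfV normrM.
  rewrite (@ger0_norm _ (N ^+ M)); last exact: le_trans ler01 NM1.
  apply: (@le_lt_trans _ _ (delta / `|q|)); last by apply: le_lt_trans dq _;
    rewrite invf_lt1// ltr1n.
  apply: ler_pM => //; first by rewrite invr_ge0 mulr_ge0// (le_trans ler01).
    exact: boxd.
  have qN0 : 0 < `|q| * N ^+ M by apply: mulr_gt0 => //;
    exact: lt_le_trans ltr01 NM1.
  by rewrite lef_pV2 ?posrE// ler_peMr// ltW.
apply: (@le_trans _ _ (Normc.normc (propagator P t (packet N) x))%:E); last first.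
  by apply: ereal_sup_ubound; exists t.
rewrite lee_fin.
have s0 i := @scale_gt0 N i N1.
have sn0 i := @scale_neq0 N i N1.
have H := @normc_propagator_gaussian_wave R n P t x (scale N) (center N)
  (\sum_(i < n) x ord0 i * center N i + meval (center N) P * t) (delta * C * C') s0.
apply: le_trans (H _); last first.
  move=> xi; have g0 := ltW (gaussian_rV_gt0 (center N) (scale N) xi).
  apply: (@le_trans _ _ (gaussian_rV (center N) (scale N) xi *
    (delta * C * weight (rescaled (center N) (scale N) xi) ^+ K))).
    by apply: ler_wpM2l => //; apply: HC => //; exact: boxd.
  have dC : 0 <= delta * C by rewrite mulr_ge0// ltW.
  have := ler_wpM2l dC (HC' (center N) (scale N) xi sn0).
  set g := gaussian_rV _ _ _; set g2 := gaussian_rV _ _ _; set W := _ ^+ K.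
  by rewrite [g * _]mulrC -[_ * W * g]mulrA -[delta * C * C' * g2]mulrA.
rewrite gaussian_mass_scale// /c.
have Nb0 : 0 <= N ^+ b by rewrite exprn_ge0// (le_trans ler01).
have dA' : 2^-1 <= 1 - delta * C * C' * Num.sqrt 2 ^+ n.
  by move: dA; rewrite /A !mulrA; lra.
have := ler_wpM2l (ltW pi0) dA'.
have S0 : 0 <= N ^+ b * Num.sqrt (pi *+ 2) ^+ n :> R by rewrite mulr_ge0//
  exprn_ge0// ltW.
move=> /(ler_wpM2r S0); apply: le_trans.
by rewrite le_eqVlt; apply/orP; left; apply/eqP; ring.
Qed.

End concentrating_packets.

(** Ensures below that the Sobolev norm of a packet does not vanish, so that the quotient is a
    genuine one. *)
Lemma gt0_integral d (T : measurableType d) (R : realType)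
    (mu : {measure set T -> \bar R}) (f : T -> \bar R) :
  measurable_fun [set: T] f -> (forall x, 0 < f x)%E -> (mu [set: T] != 0)%E ->
  (0 < \int[mu]_x f x)%E.
Proof.
move=> mf f0 muT; have f_ge0 x : (0 <= f x)%E by exact: ltW.
rewrite lt_def integral_ge0// andbT; apply: contra muT => /eqP f_eq0.
have : (\int[mu]_x `|f x| = 0)%E by under eq_integral do rewrite gee0_abs//.
move=> /(ae_eq_integral_abs mu measurableT mf)[N [mN muN0 fN]].
rewrite -measure_le0 -muN0 le_measure ?inE//.
apply: subset_trans fN => x _ /= /(_ Logic.I) fx0.
by have := f0 x; rewrite fx0 ltxx.
Qed.

(** * Sobolev norms of the packets *)

Section packet_sobolev_norm.
Context {R : realType} {n : nat}.
Variables (i1 : 'I_n) (w : 'I_n -> R) (a b : nat).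
Hypothesis ba : (b <= a)%N.
Notation leb := (@lebesgue_rV R n).
Implicit Types (N : R) (xi : 'rV[R]_n).

Lemma enorm_le_weight N xi : 1 <= N ->
  1 + enorm xi <= N ^+ a * (1 + \sum_(i < n) `|w i|) *
    weight (rescaled (center w a N) (scale i1 b N) xi).
Proof.
move=> N1; set v := rescaled _ _ _.
have Na1 : 1 <= N ^+ a by exact: exprn_ege1.
have W1 := weight_ge1 v.
have Wv : \sum_(i < n) `|v i| <= weight v - 1.
  by rewrite lerBrDl; apply: sum_le_prod.
have S0 : 0 <= \sum_(i < n) `|w i| by exact: sumr_ge0.
have xi_le i : `|xi ord0 i| <= N ^+ a * (`|w i| + `|v i|).
  rewrite -[xi ord0 i]/((fun i => xi ord0 i) i) -(freq_rescaled i1 w a b xi N1) -/v.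
  rewrite /freq mulrDr; apply: le_trans (ler_normD _ _) _.
  rewrite !normrM (@ger0_norm _ (N ^+ a)) ?(le_trans ler01)// lerD2l ler_wpM2r//.
  case: ifP => _; last by rewrite normr1.
  by rewrite ger0_norm ?exprn_ge0 ?(le_trans ler01 N1)// ler_weXn2l.
apply: (@le_trans _ _ (N ^+ a * (1 + \sum_(i < n) (`|w i| + `|v i|)))).
  rewrite mulrDr mulr1; apply: lerD => //.
  apply: le_trans (enorm_le_sum xi) _; rewrite mulr_sumr.
  by apply: ler_sum => i _.
rewrite -mulrA ler_wpM2l ?(le_trans ler01)// big_split/=.
nra.
Qed.

Lemma gaussian_rV_le1 (m s : 'I_n -> R) xi : gaussian_rV m s xi <= 1.
Proof.
apply: prodr_ile1 => i _; rewrite normal_fun_ge0/= -expR0 ler_expR.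
by rewrite mulNr oppr_le0 mulr_ge0 ?sqr_ge0// invr_ge0 mulrn_wge0// sqr_ge0.
Qed.

(** [I] is the squared norm. Since sigma >= 0, the Sobolev weight is at most N^(2 a sigma) times a
    power of the weight of v, and sigma <= 1 bounds that power by the square, which the Gaussian
    absorbs. The mass of the Gaussian supplies N^b. *)
Lemma sobolev_norm_packet (s sigma : R) : s <= sigma -> 0 <= sigma <= 1 ->
  exists2 D : R, 0 < D & forall N, 1 <= N ->
    exists2 I : R, 0 < I <= D * (N ^+ a) `^ (2 * sigma) * N ^+ b &
      sobolev_norm s (packet i1 w a b N) = (I `^ 2^-1)%:E.
Proof.
move=> s_le /andP[sg0 sg1].
have [C C0 HC] := @weight_gaussian_rV R n 2.
pose A : R := 1 + \sum_(i < n) `|w i|.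
have A1 : 1 <= A by rewrite lerDl sumr_ge0.
have pi0 : 0 < ((2 * pi) ^- n : R) by rewrite invr_gt0 exprn_gt0// mulr_gt0//
  pi_gt0.
have p20 : 0 < Num.sqrt (pi *+ 2) :> R by rewrite sqrtr_gt0 mulrn_wgt0// pi_gt0.
have s2 : 0 < Num.sqrt 2 :> R by rewrite sqrtr_gt0.
have A20 : 0 < A ^+ 2 by rewrite exprn_gt0// (lt_le_trans ltr01).
exists ((2 * pi) ^- n * (A ^+ 2 * C * Num.sqrt 2 ^+ n * Num.sqrt (pi *+ 2) ^+ n)).
  have e2 : 0 < Num.sqrt 2 ^+ n :> R by exact: exprn_gt0.
  have ep : 0 < Num.sqrt (pi *+ 2) ^+ n :> R by exact: exprn_gt0.
  by do 4?[apply: mulr_gt0 => //].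
move=> N N1.
have sc0 i := @scale_gt0 R n i1 b N i N1.
have scn0 i := @scale_neq0 R n i1 b N i N1.
set m := center w a N; set sc := scale i1 b N in sc0 scn0 *.
have Na0 : 0 <= N ^+ a by rewrite exprn_ge0// (le_trans ler01).
pose F xi : R := (1 + dotrV xi xi) `^ s * gaussian_rV m sc xi ^+ 2.
have dot_ge0 xi : 0 <= dotrV xi xi.
  by apply: sumr_ge0 => i _; rewrite -expr2 sqr_ge0.
have F0 xi : 0 < F xi.
  rewrite mulr_gt0 ?exprn_gt0 ?gaussian_rV_gt0// powR_gt0//.
  by rewrite (lt_le_trans ltr01)// lerDl.
have mF : measurable_fun [set: 'rV[R]_n] (EFin \o F).
  apply/measurable_EFinP; apply: measurable_funM.
    apply: (measurableT_comp (measurable_powR s)).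
    apply: measurable_funD => //; apply: measurable_sum => i.
    by apply: measurable_funM; exact: measurable_coord_rV.
  by apply: measurable_funX; exact: measurable_gaussian_rV.
pose B : R := (N ^+ a) `^ (2 * sigma) * (A ^+ 2 * C).
have B0 : 0 <= B by rewrite mulr_ge0 ?powR_ge0// mulr_ge0// ltW.
have FB xi : F xi <= B * gaussian_rV m (fun i => Num.sqrt 2 * sc i) xi.
  have g0 := gaussian_rV_gt0 m sc xi.
  set W := weight (rescaled m sc xi).
  have W1 : 1 <= W by exact: weight_ge1.
  have AW1 : 1 <= A * W by rewrite -[1]mulr1 ler_pM.
  have d1 : 1 <= 1 + dotrV xi xi by rewrite lerDl.
  have H1 : 1 + dotrV xi xi <= (N ^+ a * (A * W)) ^+ 2.
    rewrite mulrA; apply: le_trans (_ : (1 + enorm xi) ^+ 2 <= _).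
      have e0 : 0 <= enorm xi by exact: enorm_ge0.
      have -> : dotrV xi xi = enorm xi ^+ 2 by rewrite sqr_sqrtr.
      nra.
    rewrite lerXn2r ?enorm_le_weight// nnegrE.
      by rewrite addr_ge0// enorm_ge0.
    by rewrite -mulrA mulr_ge0// (le_trans ler01).
  have H2 : (1 + dotrV xi xi) `^ s <= (N ^+ a) `^ (2 * sigma) * (A * W) ^+ 2.
    apply: le_trans (ler_powR d1 s_le) _.
    apply: (@le_trans _ _ (((N ^+ a * (A * W)) ^+ 2) `^ sigma)).
      by apply: ge0_ler_powR => //; rewrite nnegrE ?sqr_ge0// (le_trans ler01).
    rewrite exprMn powRM ?sqr_ge0// -(powR_mulrn 2 Na0) -powRrM.
    (* Uses A W >= 1 and sigma <= 1, so that raising (A W)^2 to the power sigma does not increase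
       it. *)
    rewrite ler_wpM2l ?powR_ge0// ler1_powR//.
    by rewrite exprn_ege1.
  apply: (@le_trans _ _ ((N ^+ a) `^ (2 * sigma) * (A * W) ^+ 2 * gaussian_rV m
    sc xi)).
    apply: ler_pM => //; first exact: powR_ge0.
      by rewrite exprn_ge0// ltW.
    by rewrite expr2 ger_pMr// gaussian_rV_le1.
  have := HC m sc xi scn0; rewrite -/W => H3.
  have := ler_wpM2l (powR_ge0 (N ^+ a) (2 * sigma)) (ler_wpM2l (ltW A20) H3).
  by rewrite exprMn /B !mulrA.
have s2c i : 0 < Num.sqrt 2 * sc i by rewrite mulr_gt0.
have s2cn0 i : Num.sqrt 2 * sc i != 0 by rewrite gt_eqF.
pose J := (\int[leb]_xi (F xi)%:E)%E.
have JB : (J <= (B * (Num.sqrt 2 ^+ n * (N ^+ b * Num.sqrt (pi *+ 2) ^+ n)))%:E)%E.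
  apply: (@le_trans _ _ (\int[leb]_xi (B%:E * (gaussian_rV m (fun i => Num.sqrt 2
    * sc i) xi)%:E))%E).
    apply: ge0_le_integral => //.
    - by move=> xi _; rewrite lee_fin ltW.
    - apply: measurable_funeM; apply/measurable_EFinP;
        exact: measurable_gaussian_rV.
    - by move=> xi _; rewrite -EFinM lee_fin.
  rewrite integralZl//; last exact: integrable_gaussian_rV.
  rewrite integral_gaussian_rV// -/(gaussian_mass (fun i => Num.sqrt 2 * sc i)).
  by rewrite gaussian_mass_sqrt2// gaussian_mass_scale.
have J0 : (0 < J)%E.
  apply: gt0_integral => //.
  (* The unit cube only serves to show that the whole space has positive measure. *)
  pose b01 := @box R n (fun=> 0) (fun=> 1).
  rewrite gt_eqF//; apply: (@lt_le_trans _ _ (leb b01)).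
    rewrite lebesgue_box => [|i]; last exact: ler01.
    by rewrite lte_fin; apply: prodr_gt0 => i _; rewrite subr0.
  by apply: le_measure => //; rewrite inE//; exact: measurable_box.
have Jfin : J \is a fin_num by rewrite ge0_fin_numE ?ltW// (le_lt_trans JB)// ltry.
exists ((2 * pi) ^- n * fine J).
  rewrite mulr_gt0//=; last by rewrite fine_gt0// J0/= (le_lt_trans JB)// ltry.
  rewrite -!mulrA ler_wpM2l ?(ltW pi0)//.
  rewrite -lee_fin fineK//; apply: le_trans JB _.
  by rewrite lee_fin /B le_eqVlt; apply/orP; left; apply/eqP; ring.
rewrite -poweR_EFin EFinM fineK// /sobolev_norm; congr (((_ * _) `^ _)%E).
apply: eq_integral => xi _; rewrite fourier_gaussian_wave// /F sqr_sqrtr//.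
congr ((_ * _ ^+ 2)%:E).
by rewrite /Normc.normc /= expr0n/= addr0 sqrtr_sqr ger0_norm// ltW//
  gaussian_rV_gt0.
Qed.

End packet_sobolev_norm.

(** * Blow-up of the quotient *)

Lemma powR_nat_unbounded (R : realType) (kappa tau A : R) : 0 < kappa -> 0 < tau ->
  \forall j \near \oo, A <= kappa * (j.+1%:R : R) `^ tau.
Proof.
move=> kappa0 tau0; pose X := (`|A| / kappa) `^ tau^-1.
near=> j; have jX : X <= j.+1%:R.
  apply: (@le_trans _ _ j%:R); last by rewrite ler_nat.
  by near: j; exact: nbhs_infty_ger.
have AK0 : 0 <= `|A| / kappa by rewrite divr_ge0// ltW.
have : X `^ tau <= j.+1%:R `^ tau.
  by apply: ge0_ler_powR => //; rewrite ?nnegrE ?powR_ge0// ltW.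
rewrite -powRrM mulVf ?gt_eqF// powRr1// ler_pdivrMr// mulrC.
by apply: le_trans; exact: ler_norm.
Unshelve. all: by end_near. Qed.

Section blow_up.
Context {R : realType} {n : nat}.
Variables (i1 : 'I_n) (w : 'I_n -> R) (a b M : nat) (P : mpoly n R) (q s sigma : R).
Hypotheses (ba : (b <= a)%N) (q0 : q != 0).
Hypotheses (s_le : s <= sigma) (sigma01 : 0 <= sigma <= 1).
Hypothesis sigma_lt : 2 * a%:R * sigma < b%:R.
Hypothesis phase : growth M (fun N v =>
  meval (freq i1 w a b N v) P - meval (freq i1 w a b N (fun=> 0)) P -
  N ^+ b * v i1 * (N ^+ M * q)).

Let f (j : nat) := packet i1 w a b (j.+1%:R : R).

Lemma maximal_estimate_fails :
  (forall j, schwartz (f j) /\ (0 < sobolev_norm s (f j) < +oo)%E) /\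
  (L1_unit_ball (maximal_function P (f j)) / sobolev_norm s (f j))%E
    @[j --> \oo] --> +oo%E.
Proof.
have N1 j : 1 <= (j.+1%:R : R) by rewrite ler1n.
have [D D0 HD] := @sobolev_norm_packet R n i1 w a b ba s sigma s_le sigma01.
have [c [l [u [c0 lu lu1 Hmax]]]] := maximal_function_packet q0 phase.
split=> [j|].
  have [I /andP[I0 _] sob] := HD _ (N1 j).
  split; last by rewrite sob lte_fin powR_gt0//= ltry.
  by apply: schwartz_gaussian_wave => i; rewrite scale_neq0.
pose V := \prod_(i < n) (u i - l i).
have V0 : 0 < V by apply: prodr_gt0 => i _; rewrite subr_gt0.
(* N^b from the maximal function divided by N^(a sigma + b / 2) from the norm leaves N^tau;
   [sigma_lt] says that tau > 0. *)
pose tau := b%:R / 2 - a%:R * sigma.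
have tau0 : 0 < tau by rewrite subr_gt0 ltr_pdivlMr// mulrC mulrA.
pose kappa := c * V / D `^ 2^-1.
have Dh0 : 0 < D `^ 2^-1 by exact: powR_gt0.
have kappa0 : 0 < kappa by rewrite divr_gt0// mulr_gt0.
apply/cvgeyPge => A; near=> j.
have Aj : A <= kappa * (j.+1%:R : R) `^ tau.
  by near: j; exact: powR_nat_unbounded.
set N : R := j.+1%:R in Aj *.
have N0 : 0 < N by exact: lt_le_trans ltr01 (N1 j).
have [I /andP[I0 ID] sob] := HD _ (N1 j).
have Nb0 : 0 < N ^+ b by exact: exprn_gt0.
have L1 : ((c * N ^+ b * V)%:E <= L1_unit_ball (maximal_function P (f j)))%E.
  rewrite EFinM -[X in (_ * X)%E]lebesgue_box => [|i]; last exact: ltW.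
  apply: ge_cst_integral => //.
  - exact: measurable_box.
  - by rewrite mulr_ge0// ltW.
  - by move=> x bx; apply: le_trans (lee_abs _); exact: Hmax (N1 j) bx.
have Ih0 : 0 < I `^ 2^-1 by exact: powR_gt0.
rewrite sob inver gt_eqF//.
apply: (@le_trans _ _ ((c * N ^+ b * V)%:E * ((I `^ 2^-1)^-1)%:E)%E); last first.
  by rewrite lee_pmul2r// lte_fin invr_gt0.
rewrite -EFinM lee_fin; apply: le_trans Aj _.
have Ih : I `^ 2^-1 <= D `^ 2^-1 * N `^ (a%:R * sigma + b%:R / 2).
  have -> : D `^ 2^-1 * N `^ (a%:R * sigma + b%:R / 2) =
      (D * (N ^+ a) `^ (2 * sigma) * N ^+ b) `^ 2^-1.
    rewrite !powRM ?powR_ge0// ?mulr_ge0 ?powR_ge0 ?exprn_ge0 ?ltW//.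
    rewrite -!powR_mulrn ?ltW// -!powRrM -mulrA -powRD ?(gt_eqF N0) ?implybT//.
    by congr (_ * _ `^ _); field.
  by apply: ge0_ler_powR => //; rewrite ?nnegrE ?(le_trans _ ID)// ltW.
rewrite ler_pdivlMr//; apply: (@le_trans _ _ (kappa * N `^ tau * (D `^ 2^-1 * N
  `^ (a%:R * sigma + b%:R / 2)))).
  by rewrite ler_wpM2l// mulr_ge0 ?powR_ge0// ltW.
have NE : N `^ tau * N `^ (a%:R * sigma + b%:R / 2) = N ^+ b.
  rewrite -powRD ?(gt_eqF N0) ?implybT// -powR_mulrn ?ltW//; congr (_ `^ _).
  by rewrite /tau; field.
rewrite le_eqVlt; apply/orP; left; apply/eqP.
rewrite mulrACA NE /kappa; field.
by rewrite gt_eqF.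
Unshelve. all: by end_near. Qed.

End blow_up.

(** The left side equals d k - i and the right side d k - d, so the inequality is just d <= i. *)
Lemma concentration_exponent (d i k : nat) : (0 < d)%N -> (d <= i <= k)%N ->
  (d.-1 * i + d * (k - i) <= d * (k - 1))%N.
Proof.
case: d => // e _ /andP[]; case: i => // i ei ik /=.
have -> : (k - 1 = i + (k - i.+1))%N by rewrite -[in LHS](subnKC ik) addSn subn1.
by rewrite mulnDr leq_add2r mulnS mulSn leq_add2r.
Qed.

Theorem theorem1p6 (R : realType) (n k : nat) (hn : (2 <= n)%N) (hk : (2 <= k)%N)
    (P : mpoly n R) (Q : nat -> mpoly n R)
    (d : nat) (Sigma : {set 'I_n}) (s : R) :
  let X1 : 'I_n := Ordinal (ltnW hn) in
  let X2n : {set 'I_n} := [set~ X1]%SET in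
  mmeasure mdeg P = k.+1 ->
  (forall i, (i <= k)%N ->
     Q (k - i)%N \is ishomog1 (k - i)%N mdeg /\ mpoly_in X2n (Q (k - i)%N)) ->
  pihomog mdeg k P =
    \sum_(i < k.+1) mpolyX R (mnm1 X1) ^+ i * Q (k - i)%N ->
  (2 <= d <= k)%N ->
  Sigma \proper X2n ->
  (forall i, (2 <= i <= d - 1)%N -> mpoly_in Sigma (Q (k - i)%N)) ->
  (exists2 m, m \in msupp (Q (k - 1)%N) & monomial_in (X2n :\: Sigma)%SET m) ->
  s < (if [forall i : 'I_k.+1, (d <= i)%N ==> (Q (k - i)%N == 0)]
       then 1 / 2%:R else (d%:R - 1) / (2%:R * d%:R)) ->
  exists (r : nat -> R) (f : nat -> 'rV[R]_n -> R[i]),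
    [/\ r @ \oo --> +oo,
        forall j, schwartz (f j) /\ (0 < sobolev_norm s (f j) < +oo)%E &
        (L1_unit_ball (maximal_function P (f j)) / sobolev_norm s (f j))%E
          @[j --> \oo] --> +oo%E].
Proof.
move=> X1 X2n sP hQ PE /andP[d2 dk] SX hS [m0 m0Q m0S] hs.
have [w [w0 qw]] := mpoly_nonvanishing m0Q m0S.
set flat := [forall i : 'I_k.+1, _] in hs.
(* In the flat case no term with i >= d constrains b / a beyond b <= a. In both cases b / (2 a) is
   the bound on s in the statement. *)
pose a := if flat then 1%N else d; pose b := if flat then 1%N else d.-1.
have d0 : 0 < (d%:R : R) by rewrite ltr0n; exact: ltnW.
have ba : (b <= a)%N by rewrite /a /b; case: ifP => // _; exact: leq_pred.
have b0 : 0 < (b%:R : R).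
  by rewrite ltr0n /b; case: ifP => // _; rewrite -ltnS prednK// ltnW.
have a0 : 0 < (a%:R : R) by rewrite (lt_le_trans b0)// ler_nat.
pose sigma := Num.max s 0.
have sigma0 : 0 <= sigma by rewrite le_max lexx orbT.
have sigma_lt : 2 * a%:R * sigma < b%:R.
  rewrite /sigma maxEle; case: ifP => _; first by rewrite mulr0.
  move: hs; rewrite /a /b; case: ifP => _ hs; first by lra.
  rewrite -subn1 natrB ?(ltnW d2)//.
  by move: hs; rewrite ltr_pdivlMr ?mulr_gt0// mulrC.
(* From 2 a sigma < b <= a. *)
have sigma1 : sigma <= 1.
  have ba' : (b%:R : R) <= a%:R by rewrite ler_nat.
  rewrite leNgt; apply/negP => s1; have := lt_le_trans sigma_lt ba'.
  rewrite ltNge => /negP; apply.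
  by rewrite -mulrA mulrCA ler_peMr ?(ltW a0)// mulr_ege1 ?ler1n ?(ltW s1).
have hd i : (d <= i <= k)%N -> Q (k - i)%N = 0 \/ (b * i + a * (k - i) <= a * (k - 1))%N.
  move=> /andP[di ik]; rewrite /a /b; case: ifPn => [/forallP flatE|_].
    by left; have := flatE (Ordinal (ik : (i < k.+1)%N)); rewrite /= di => /eqP.
  by right; apply: concentration_exponent; [exact: ltnW|rewrite di].
have growthP := growth_phase hk ba (introT andP (conj d2 dk)) sP hQ PE SX hS hd w0.
have s_le : s <= sigma by rewrite le_max lexx.
have [Hf Hratio] := maximal_estimate_fails ba qw s_le
  (introT andP (conj sigma0 sigma1)) sigma_lt growthP.
(* The shift by one keeps N >= 1, as all the growth estimates require. *)
exists (fun j => j.+1%:R), (fun j => packet X1 w a b j.+1%:R); split => //.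
apply/cvgryPge => A; near=> j; apply: (@le_trans _ _ j%:R); last by rewrite ler_nat.
by near: j; exact: nbhs_infty_ger.
Unshelve. all: by end_near. Qed.
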